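(* Let $I=[0,2\pi]$, let $a\geq 0$ and $b\in\mathbb{R}$, $b\neq 0$, be constants, and let $f\in C(I)$ with $f(0)=f(2\pi)$. Consider the equation $$-\frac{d^{2}u}{dx^{2}}+\frac{d^{4}u}{dx^{4}}-b\frac{du}{dx}-au=f(x),\quad x\in I. \qquad (\ast)$$ a) If $a>0$, then $(\ast)$ has a unique solution $u\in H^{4}(I)$. b) If $a=0$, then $(\ast)$ admits a unique solution $u\in H_{0}^{4}(I)$ if and only if the orthogonality relation $(f(x),1)_{L^{2}(I)}=0$ holds.
   Context: Functions are complex-valued and $I=[0,2\pi]$. Here $H^{4}(I)$ denotes the space with periodic boundary conditions $$H^{4}(I)=\{u:I\to\mathbb{C}\ |\ u,u''''\in L^{2}(I),\ u(0)=u(2\pi),\ u'(0)=u'(2\pi),\ u''(0)=u''(2\pi),\ u'''(0)=u'''(2\pi)\},$$ with norm $\|u\|_{H^{4}(I)}^{2}:=\|u\|_{L^{2}(I)}^{2}+\left\|\frac{d^{4}u}{dx^{4}}\right\|_{L^{2}(I)}^{2}$ (derivatives in the weak sense). The inner product is $(f,g)_{L^{2}(I)}:=\int_{0}^{2\pi}f(x)\overline{g(x)}\,dx$, so $(f(x),1)_{L^{2}(I)}=\int_{0}^{2\pi}f(x)\,dx$. The constrained subspace is (not the usual zero-trace space) $$H_{0}^{4}(I)=\{u\in H^{4}(I)\ |\ (u(x),1)_{L^{2}(I)}=0\}.$$ The equation is understood as an equality in $L^{2}(I)$. *)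

(* Defs.v *)
From HB Require Import structures.
From mathcomp Require Import all_boot all_order all_algebra.
From mathcomp Require Import all_classical all_reals all_analysis.
From mathcomp Require Import complex.

Set Implicit Arguments.
Unset Strict Implicit.
Unset Printing Implicit Defensive.

Import Order.TTheory GRing.Theory Num.Theory.
Import numFieldNormedType.Exports.

Local Open Scope classical_set_scope.
Local Open Scope ring_scope.

(* Complex-valued functions on I = [0, 2 pi] are represented by functions R -> R[i]: no
   definition below depends on the values outside I, and the elements of L^2(I)
   and H^4(I) are such functions up to equality almost everywhere on I. *)

Section Sobolev.
Variable R : realType.
Local Notation mu := (@lebesgue_measure R).

Definition I2pi : set R := `[0, 2 * pi]%classic.

Definition cintegral (u : R -> R[i]) : R[i] :=
  Complex (\int[mu]_(x in I2pi) complex.Re (u x))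
          (\int[mu]_(x in I2pi) complex.Im (u x)).

Definition inner (u v : R -> R[i]) : R[i] :=
  cintegral (fun x => u x * (v x)^*%C).

(* The norm of R[i] takes values in R[i], hence the real part. *)
Definition L2 (u : R -> R[i]) : Prop :=
  [/\ measurable_fun I2pi (fun x => complex.Re (u x)),
      measurable_fun I2pi (fun x => complex.Im (u x)) &
      (\int[mu]_(x in I2pi) ((complex.Re `|u x|) ^+ 2)%:E < +oo)%E].

(* phi belongs to C_c^oo of the open interval. The support is a closed subset
   of R contained in a bounded interval, so it is compact. *)
Definition test_function (phi : R -> R) : Prop :=
  (forall (n : nat) (x : R), derivable (derive1n n phi) x 1) /\
  closure [set x | phi x != 0] `<=` `]0, 2 * pi[.

(* v is the n-th weak derivative of u on the open interval; by linearity it is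
   enough to test against real-valued functions. For n = 0 this says that u and
   v agree almost everywhere on I. *)
Definition weak_derivative (n : nat) (u v : R -> R[i]) : Prop :=
  forall phi : R -> R, test_function phi ->
    cintegral (fun x => u x * (derive1n n phi x)%:C%C) =
    (-1) ^+ n * cintegral (fun x => v x * (phi x)%:C%C).

(* The boundary values of the n-th weak derivative of u are those of its
   continuous representative v on the closed interval. *)
Definition periodic_derivative (n : nat) (u : R -> R[i]) : Prop :=
  exists v : R -> R[i]^o,
    [/\ {within I2pi, continuous v}, weak_derivative n u v & v 0 = v (2 * pi)].

Definition H4 (u : R -> R[i]) : Prop :=
  [/\ L2 u,
      exists2 v, L2 v & weak_derivative 4 u v &
      forall n : nat, (n < 4)%N -> periodic_derivative n u].

Definition H40 (u : R -> R[i]) : Prop := H4 u /\ inner u (cst 1) = 0.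

Definition solution (a b : R) (f u : R -> R[i]) : Prop :=
  exists u1 u2 u4 : R -> R[i],
    [/\ L2 u1 /\ weak_derivative 1 u u1,
        L2 u2 /\ weak_derivative 2 u u2,
        L2 u4 /\ weak_derivative 4 u u4 &
        {ae mu, forall x, I2pi x ->
          - u2 x + u4 x - b%:C%C * u1 x - a%:C%C * u x = f x}].

Definition exists_unique_ae (P : (R -> R[i]) -> Prop) : Prop :=
  exists u, P u /\
    forall v, P v -> {ae mu, forall x, I2pi x -> v x = u x}.

End Sobolev.

Arguments I2pi {R}.

(* Main.v *)
Require Import Defs.
From mathcomp Require Import all_boot all_order all_algebra.
From mathcomp Require Import all_classical all_reals all_analysis.
From mathcomp Require Import measurable_realfun.
From mathcomp Require Import complex.
From mathcomp Require Import ring lra.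
Import Order.TTheory GRing.Theory Num.Theory.
Import numFieldNormedType.Exports.
Local Open Scope classical_set_scope.
Local Open Scope ring_scope.

Set Implicit Arguments.
Unset Strict Implicit.
Unset Printing Implicit Defensive.

(** The coefficients are real, so the real and the imaginary part of a solution
    solve the equation separately, and everything except the construction of
    solutions is done for real functions.

    Uniqueness is an energy argument. For a periodic solution w of the
    homogeneous equation w'''' = w'' + b w' + a w, the function
      w''' w' - (w''^2 + w'^2 + a w^2) / 2
    has derivative b w'^2, which does not change sign, and takes the same value
    at both ends of the interval; hence w' = 0, then w'' = w''' = w'''' = 0, and
    the equation leaves a w = 0 (energy_derive0, energy_zero_order). If a > 0
    then w = 0; if a = 0 then w is a constant, which the mean-zero condition
    makes zero.

    Existence comes from factoring the characteristic polynomial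
    X^4 - X^2 - b X - a over the complex numbers. The operator D - z with
    periodic boundary conditions is inverted by variation of constants as soon
    as exp(2 pi z) <> 1, and these inverses are composed (solve_prod). A nonzero
    root z with exp(2 pi z) = 1 would give the nonconstant periodic solution
    exp(z x) of the homogeneous equation, which the energy argument excludes
    (nonresonant); thus no location of the roots has to be computed. For a > 0
    the number 0 is not a root. For a = 0 it is a root, so that a primitive of f
    is taken first and the remaining cubic is inverted; the primitive is
    periodic exactly when f has mean zero. Conversely, for a = 0 the equation
    exhibits f as the derivative of the periodic function u''' - u' - b u
    (solvable_integral0).

    The link between the weak notions and classical derivatives is the lemma of
    du Bois-Reymond: a continuous function with a continuous weak derivative is
    differentiable (du_bois_reymond). The boundary conditions provide continuous
    representatives of u, ..., u''', and the equation itself then provides one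
    of u''''; so a weak solution is a classical one (solution_is_strong), to
    which the energy argument applies. Representatives are compared almost
    everywhere by the fundamental lemma of the calculus of variations
    (cutoff_fundamental, rweak0_ae). Both lemmas need enough test functions, and
    these are products of two functions obtained from t |-> exp(- 1 / t), extended by 0
    to t <= 0, by affine changes of variable. *)

(** * Smooth functions and a flat function *)

Section Smooth.
Variable R : realType.
Implicit Types (f g : R -> R) (p : {poly R}).

(** The usual rules of differentiation, in the form of explicit abstractions,
    against which pointwise expressions unify. *)
Lemma is_derive_fD f g (x df dg : R) : is_derive x 1 f df ->
  is_derive x 1 g dg -> is_derive x 1 (fun y => f y + g y) (df + dg).
Proof. exact: is_deriveD. Qed.

Lemma is_derive_fB f g (x df dg : R) : is_derive x 1 f df ->
  is_derive x 1 g dg -> is_derive x 1 (fun y => f y - g y) (df - dg).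
Proof. exact: is_deriveB. Qed.

Lemma is_derive_fM f g (x df dg : R) : is_derive x 1 f df ->
  is_derive x 1 g dg ->
  is_derive x 1 (fun y => f y * g y) (df * g x + f x * dg).
Proof. by move=> h k; rewrite addrC [df * _]mulrC; exact: is_deriveM. Qed.

Lemma is_derive_fcM f (c x df : R) : is_derive x 1 f df ->
  is_derive x 1 (fun y => c * f y) (c * df).
Proof. exact: is_deriveZ. Qed.

Lemma is_derive_fcomp f g (x df dg : R) : is_derive (g x) 1 f df ->
  is_derive x 1 g dg -> is_derive x 1 (fun y => f (g y)) (df * dg).
Proof. by move=> h k; exact: (is_derive1_comp h k). Qed.

(** The recursion differentiates first, whereas derive1n differentiates last;
    this form is the one that makes the product rule an induction. *)
Fixpoint ndiff (n : nat) (f : R -> R) : Prop :=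
  if n is m.+1 then (forall x, derivable f x 1) /\ ndiff m (derive1 f) else True.

Lemma ndiffW n f : ndiff n.+1 f -> ndiff n f.
Proof. by elim: n f => [|n IH] f //= [df /IH]; split. Qed.

Lemma derive1_is_derive f (f' : R -> R) :
  (forall x : R, is_derive x 1 f (f' x)) -> derive1 f = f'.
Proof. by move=> h; apply/funext => x; rewrite derive1E; have [_ ->] := h x. Qed.

Lemma ndiffD n f g : ndiff n f -> ndiff n g -> ndiff n (f + g).
Proof.
elim: n f g => [|n IH] f g //= [df nf] [dg ng]; split.
  by move=> x; apply: derivableD.
rewrite (_ : derive1 (f + g) = derive1 f + derive1 g); first exact: IH.
by apply/funext => x; rewrite !fctE !derive1E deriveD.
Qed.

Lemma ndiffM n f g : ndiff n f -> ndiff n g -> ndiff n (f * g).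
Proof.
elim: n f g => [|n IH] f g //= [df nf] [dg ng]; split.
  by move=> x; apply: derivableM.
rewrite (_ : derive1 (f * g) = f * derive1 g + g * derive1 f); last first.
  by apply/funext => x; rewrite !fctE !derive1E deriveM.
by apply: ndiffD; apply: IH => //; apply: ndiffW.
Qed.

Lemma ndiff_cst n (c : R) : ndiff n (cst c).
Proof.
elim: n c => [|n IH] c //=; split=> [x|]; first exact: derivable_cst.
by rewrite (_ : derive1 (cst c) = cst 0) //; apply: derive1_is_derive.
Qed.

Lemma ndiff_affine n f (k c : R) : ndiff n f -> ndiff n (fun x => f (k * x + c)).
Proof.
elim: n f => [|n IH] f //= [df nf].
have D (x : R) : is_derive x 1 (fun x : R => f (k * x + c)) (k * derive1 f (k * x + c)).
  rewrite mulrC derive1E; apply: is_derive_fcomp; first exact/derivableP.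
  by apply: is_derive_eq; rewrite -[k%:A]/(k * 1) mulr1 addr0.
split=> [x|]; first by have [] := D x.
rewrite (derive1_is_derive D).
apply: (@ndiffM n (cst k) (fun x => derive1 f (k * x + c))); last exact: IH.
exact: ndiff_cst.
Qed.

Lemma derive1n_ndiff f :
  (forall n x, derivable (derive1n n f) x 1) <-> forall n, ndiff n f.
Proof.
split=> [h n|h n].
  elim: n f h => [|n IH] f h //=; split; first exact: (h 0%N).
  by apply: IH => m; rewrite /derive1n -iterSr; exact: (h m.+1).
elim: n f h => [|n IH] f h; first by have [] := h 1%N.
by rewrite /derive1n iterSr; apply: IH => m; have [] := h m.+1.
Qed.

(** Raise e^(t/n) >= t/n to the power n. *)
Lemma exprn_expRN_le (n : nat) (t : R) : 0 <= t -> t ^+ n * expR (- t) <= n%:R ^+ n.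
Proof.
case: n => [|n] t0; first by rewrite mul1r expR_le1 oppr_le0.
rewrite expRN ler_pdivrMr ?expR_gt0 //.
have n0 : 0 < n.+1%:R :> R by rewrite ltr0n.
have -> : expR t = expR (t / n.+1%:R) ^+ n.+1.
  by rewrite -expRM_natl mulrC divfK ?gt_eqF.
rewrite -exprMn lerXn2r ?nnegrE ?mulr_ge0 ?expR_ge0 ?ler0n //.
rewrite -ler_pdivrMl // mulrC (le_trans _ (expR_ge1Dx _)) //.
by rewrite lerDr.
Qed.

Lemma horner_expRN_bounded p :
  exists C : R, forall t, 0 <= t -> `|p.[t] * expR (- t)| <= C.
Proof.
exists (\sum_(i < size p) `|p`_i| * i%:R ^+ i) => t t0.
rewrite horner_coef mulr_suml (le_trans (ler_norm_sum _ _ _)) //.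
apply: ler_sum => i _; rewrite -mulrA normrM ler_wpM2l //.
by rewrite ger0_norm ?exprn_expRN_le // mulr_ge0 ?exprn_ge0 ?expR_ge0.
Qed.

Lemma is_derive0_quadratic f (C : R) :
  (forall h, `|f h| <= C * h ^+ 2) -> is_derive (0 : R) 1 f 0.
Proof.
move=> fC.
have f0 : f 0 = 0.
  by apply/eqP; rewrite -normr_le0; have := fC 0; rewrite expr0n mulr0.
have C0 : 0 <= C by have := fC 1; rewrite expr1n mulr1; apply: le_trans.
have cv : h^-1 *: (f (h *: 1 + 0) - f 0) @[h --> 0^'] --> (0 : R).
  apply/cvgr0Pnorm_le => e e0.
  have d0 : 0 < e / (C + 1) by rewrite divr_gt0 // ltr_wpDl.
  near=> h.
  have hn0 : h != 0 by near: h; exact: nbhs_dnbhs_neq.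
  rewrite f0 subr0 addr0 -[h *: 1]/(h * 1) mulr1 -[_ *: _]/(_ * _) normrM normfV.
  rewrite ler_pdivrMl ?normr_gt0 // (le_trans (fC _)) //.
  rewrite -normr_id -[h ^+ 2]ger0_norm ?sqr_ge0 // normrX expr2 mulrA mulrC normr_id.
  rewrite ler_wpM2l //.
  have : `|h| <= e / (C + 1).
    by near: h; apply: dnbhs0_le.
  rewrite ler_pdivlMr ?ltr_wpDl // => he.
  apply: le_trans he; rewrite mulrC ler_wpM2l // lerDl //.
apply: DeriveDef; first by apply/cvg_ex; exists 0.
exact: cvg_lim.
Unshelve. all: by end_near. Qed.

(** The family of all flat p is closed under differentiation, which makes each
    member smooth; flat 1 is the classical t |-> exp(- 1 / t), extended by 0. *)
Definition flat p (t : R) : R := if 0 < t then p.[t^-1] * expR (- t^-1) else 0.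

(** With t = 1 / h, the bound is the boundedness of p(t) t^2 e^-t; it yields the
    derivative 0 at the origin. *)
Lemma flat_quadratic p : exists C : R, forall h, `|flat p h| <= C * h ^+ 2.
Proof.
have [C hC] := horner_expRN_bounded (p * 'X^2); exists C => h; rewrite /flat.
have C0 : 0 <= C by apply: le_trans (hC 0 _).
case: ifPn => [h0|_]; last by rewrite normr0 mulr_ge0 ?sqr_ge0.
rewrite -ler_pdivrMr ?exprn_gt0 //.
have := hC h^-1 (ltW _); rewrite invr_gt0 => /(_ h0).
rewrite hornerM hornerXn mulrAC normrM (ger0_norm (sqr_ge0 _)).
by rewrite exprVn.
Qed.

Lemma is_derive_flat p (x : R) :
  is_derive x 1 (flat p) (flat ('X^2 * (p - p^`())) x).
Proof.
have [x0|x0|->] := ltgtP x 0.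
- rewrite {2}/flat ltNge (ltW x0) /=.
  apply: (@near_eq_is_derive _ _ _ (cst 0)).
  near=> y; rewrite /flat ltNge (ltW _) //.
  by near: y; exact: lt_nbhsl.
- rewrite {2}/flat x0.
  pose g y := p.[y^-1] * expR (- y^-1) : R.
  apply: (@near_eq_is_derive _ _ _ g).
    near=> y; rewrite /flat ifT //.
    by near: y; exact: lt_nbhsr.
  have xn0 : x != 0 by rewrite gt_eqF.
  have dV : is_derive x 1 (fun y : R => y^-1) (- x ^- 2).
    apply: (is_derive_eq (is_deriveV xn0 (is_derive_id x 1))).
    by rewrite -[_ *: _]/(_ * _) mulr1.
  have dp : is_derive x 1 (fun y : R => p.[y^-1]) (- x ^- 2 * p^`().[x^-1]).
    by rewrite mulrC; apply: is_derive_fcomp.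
  have de : is_derive x 1 (fun y : R => expR (- y^-1)) (x ^- 2 * expR (- x^-1)).
    rewrite -[x ^- 2]opprK.
    rewrite mulrC; apply: is_derive_fcomp; exact: is_deriveN.
  apply: (is_derive_eq (is_derive_fM dp de)).
  rewrite hornerM hornerXn hornerD hornerN exprVn.
  set u := x ^- 2; set e := expR _; set p1 := p.[_]; set p2 := _.[_]; ring.
- rewrite {2}/flat ltxx; have [C hC] := flat_quadratic p.
  exact: is_derive0_quadratic hC.
Unshelve. all: by end_near. Qed.

Lemma ndiff_flat n p : ndiff n (flat p).
Proof.
elim: n p => [|n IH] p //=; split=> [x|]; first by have [] := is_derive_flat p x.
by rewrite (derive1_is_derive (is_derive_flat p)).
Qed.

End Smooth.

(** * Cutoff functions and the fundamental lemma *)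

Section Cutoff.
Variable R : realType.
Implicit Types (f g h : R -> R).
Local Notation mu := (@lebesgue_measure R).

(** A smooth function positive exactly on ]c, d[, which tends pointwise to the
    indicator of ]c, d[ as k goes to infinity. The arguments are written as
    affine functions of x in view of ndiff_affine. *)
Definition cutoff (c d k x : R) : R :=
  flat 1 (k * x + - (k * c)) * flat 1 ((- k) * x + k * d).

Lemma cutoff_ndiff (c d k : R) n : ndiff n (cutoff c d k).
Proof. by apply: ndiffM; apply: ndiff_affine; apply: ndiff_flat. Qed.

Lemma flat1_ge0 (t : R) : 0 <= flat 1 t.
Proof. by rewrite /flat hornerC mul1r; case: ifP => // _; exact: expR_ge0. Qed.

Lemma flat1_le1 (t : R) : flat 1 t <= 1.
Proof.
rewrite /flat hornerC mul1r; case: ifP => // t0.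
by rewrite expR_le1 oppr_le0 invr_ge0 ltW.
Qed.

Lemma cutoffE c d k x :
  cutoff c d k x = flat 1 (k * (x - c)) * flat 1 (k * (d - x)).
Proof. by rewrite /cutoff mulNr -mulrN -mulrDr [- _ + _]addrC -mulrBr. Qed.

Lemma cutoff_gt0 (c d k x : R) : 0 < k -> (0 < cutoff c d k x) = (c < x < d).
Proof.
move=> k0; rewrite cutoffE /flat !hornerC !mul1r !(pmulr_rgt0 _ k0) !subr_gt0.
by case: ifP => _; case: ifP => _; rewrite ?mulr0 ?mul0r ?ltxx // mulr_gt0 ?expR_gt0.
Qed.

Lemma cutoff_ge0 c d k x : 0 <= cutoff c d k x.
Proof. by rewrite mulr_ge0 ?flat1_ge0. Qed.

Lemma cutoff_le1 c d k x : cutoff c d k x <= 1.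
Proof. by rewrite mulr_ile1 ?flat1_ge0 ?flat1_le1. Qed.

Lemma supported_test_function (f : R -> R) (c d : R) : (forall n, ndiff n f) ->
  0 < c -> d < 2 * pi -> (forall x, f x != 0 -> c <= x <= d) -> test_function f.
Proof.
move=> nf c0 dp supp; split; first exact/derive1n_ndiff.
move=> x /(closure_subset (B := `[c, d])) cl; have : `[c, d]%classic x.
  apply: (itv_closed (T := R)); apply: cl => y /= /supp; by rewrite in_itv.
rewrite /= !in_itv /= => /andP[cx xd].
by rewrite (lt_le_trans c0 cx) (le_lt_trans xd dp).
Qed.

Lemma test_cutoff (c d k : R) : 0 < k -> 0 < c -> d < 2 * pi ->
  test_function (cutoff c d k).
Proof.
move=> k0 c0 dp; apply: (@supported_test_function _ c d) => // [n|x].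
  exact: cutoff_ndiff.
move=> n0; have : 0 < cutoff c d k x by rewrite lt_neqAle eq_sym n0 cutoff_ge0.
by rewrite cutoff_gt0 // => /andP[/ltW -> /ltW ->].
Qed.

Lemma cvg_flat1 (t : R) : 0 < t -> flat 1 (n.+1%:R * t) @[n --> \oo] --> (1 : R).
Proof.
move=> t0; rewrite -[X in _ --> X](@expR0 R).
rewrite (_ : (fun n => _) = fun n => expR (- (t^-1 * n.+1%:R^-1))); last first.
  apply/funext => n; rewrite /flat hornerC mul1r mulr_gt0 ?ltr0n //.
  by rewrite invfM mulrC.
apply: (@cvg_comp _ _ _ (fun n => - (t^-1 * n.+1%:R^-1)) expR _ (nbhs (0 : R)));
  last exact: continuous_expR.
rewrite -[0 in X in _ `=>` X]oppr0; apply: cvgN.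
rewrite -[X in _ --> X](mulr0 t^-1); apply: cvgMl_tmp.
exact: cvg_harmonic.
Qed.

Lemma cvg_cutoff (c d x : R) :
  cutoff c d n.+1%:R x @[n --> \oo] --> (\1_(`]c, d[) x : R).
Proof.
rewrite indicE mem_setE in_itv /=; case: (boolP (c < x < d)) => [/andP[cx xd]|ncd].
  rewrite (_ : (fun n => _) = fun n =>
      flat 1 (n.+1%:R * (x - c)) * flat 1 (n.+1%:R * (d - x))); last first.
    by apply/funext => n; rewrite cutoffE.
  rewrite -[X in _ --> X](mulr1 (1 : R)); apply: cvgM; apply: cvg_flat1.
    by rewrite subr_gt0.
  by rewrite subr_gt0.
rewrite (_ : (fun n => _) = cst 0); first exact: cvg_cst.
apply/funext => n; apply/eqP; rewrite -[_ == _]negbK.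
apply: contra ncd => n0; rewrite -(@cutoff_gt0 c d n.+1%:R x) ?ltr0n //.
by rewrite lt_neqAle eq_sym n0 cutoff_ge0.
Qed.

Lemma measurable_cutoff c d k (D : set R) : measurable_fun D (cutoff c d k).
Proof.
apply: measurable_funTS; apply: continuous_measurable_fun => x.
apply: differentiable_continuous; apply/derivable1_diffP.
by have [] := cutoff_ndiff c d k 1.
Qed.

Lemma integrable_bounded_mul (D : set R) g h : measurable D ->
  measurable_fun D h -> (forall x, `|h x| <= 1) ->
  mu.-integrable D (EFin \o g) -> mu.-integrable D (EFin \o (g \* h)).
Proof.
move=> mD mh h1 ig; have /measurable_EFinP mg := measurable_int mu ig.
apply: le_integrable ig => //.
  by apply/measurable_EFinP; apply: measurable_funM.
by move=> x _; rewrite /= lee_fin normrM ler_piMr.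
Qed.

Lemma norm_cutoff_le1 c d k x : `|cutoff c d k x| <= 1.
Proof. by rewrite ger0_norm ?cutoff_ge0 ?cutoff_le1. Qed.

Lemma integral_cutoff_cvg (D : set R) g (c d : R) : measurable D ->
  mu.-integrable D (EFin \o g) ->
  \int[mu]_(x in D) (g x * cutoff c d n.+1%:R x) @[n --> \oo]
    --> \int[mu]_(x in D) (g x * \1_(`]c, d[) x).
Proof.
move=> mD ig.
have mi : measurable_fun D (\1_(`]c, d[) : R -> R) by exact: measurable_indic.
have i1 x : `|\1_(`]c, d[) x : R| <= 1.
  by rewrite indicE; case: (_ \in _); rewrite ?normr1 ?normr0.
have hi : mu.-integrable D (EFin \o (g \* \1_(`]c, d[))).
  exact: integrable_bounded_mul.
have hn n : mu.-integrable D (EFin \o (g \* cutoff c d n.+1%:R)).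
  apply: integrable_bounded_mul => //; first exact: measurable_cutoff.
  exact: norm_cutoff_le1.
have [] := @dominated_convergence _ _ R mu D mD
  (fun n => EFin \o (g \* cutoff c d n.+1%:R)) (EFin \o (g \* \1_(`]c, d[)))
  (abse \o (EFin \o g)).
- by move=> n; exact: (measurable_int mu (hn n)).
- exact: (measurable_int mu hi).
- apply: aeW => x _; apply: cvg_EFin; first by near=> n.
  by apply: cvgMl_tmp; exact: cvg_cutoff.
- exact: integrable_abse.
- apply: aeW => x n _ /=; rewrite lee_fin normrM ler_piMr //.
  exact: norm_cutoff_le1.
move=> _ _; rewrite -[X in _ --> X]fineK; last exact: integrable_fin_num.
by move/fine_cvg.
Unshelve. all: by end_near. Qed.

(** By dominated convergence, integrals against the cutoffs determine the
    integrals over the subintervals. *)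
Lemma cutoff_integral_itv_eq0 g (c d : R) : mu.-integrable I2pi (EFin \o g) ->
  0 < c -> d < 2 * pi ->
  (forall n, \int[mu]_(x in I2pi) (g x * cutoff c d n.+1%:R x) = 0) ->
  \int[mu]_(x in `]c, d[) g x = 0.
Proof.
move=> ig c0 dp h; have mI : measurable (@I2pi R) by exact: measurable_itv.
have := integral_cutoff_cvg (c := c) (d := d) mI ig.
rewrite (_ : (fun n => _) = cst 0); last by apply/funext => n; rewrite h.
move=> cv.
have E : \int[mu]_(x in I2pi) (g x * \1_`]c, d[ x) = 0.
  exact: (cvg_unique (@Rhausdorff R) cv (cvg_cst (0 : R))).
have IE : `]c, d[%classic = `]c, d[%classic `&` I2pi :> set R.
  rewrite setIidl // => x; rewrite /I2pi /= !in_itv /= => /andP[cx xd].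
  by rewrite (ltW (lt_trans c0 cx)) (ltW (lt_trans xd dp)).
rewrite [in LHS]IE Rintegral_mkcondl -E; apply: eq_Rintegral => x _.
by rewrite patchE indicE; case: ifP; rewrite ?mulr1 ?mulr0.
Qed.

(** The primitive of g is constant on ]0, 2 pi[, and by Lebesgue's
    differentiation theorem g is almost everywhere its derivative. *)
Lemma cutoff_fundamental g : mu.-integrable I2pi (EFin \o g) ->
  (forall c d n, 0 < c -> d < 2 * pi ->
     \int[mu]_(x in I2pi) (g x * cutoff c d n.+1%:R x) = 0) ->
  {ae mu, forall x, 0 < x < 2 * pi -> g x = 0}.
Proof.
move=> ig h; have mI : measurable (@I2pi R) by exact: measurable_itv.
have ig0 : mu.-integrable setT (EFin \o (g \_ I2pi)).
  by rewrite -restrict_EFin; apply/integrable_restrict => //=; rewrite setTI.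
have igS a y : mu.-integrable [set` Interval a (BRight y)] (EFin \o (g \_ I2pi)).
  exact: integrableS ig0.
pose F x := \int[mu]_(t in `[0, x]) (g \_ I2pi) t.
have Fle (c d : R) : 0 < c -> c <= d -> d < 2 * pi -> F c = F d.
  move=> c0 cd dp; apply/eqP; rewrite eq_sym -subr_eq0; apply/eqP.
  rewrite /F (Rintegral_itvB (igS _ _)) ?bnd_simp ?(ltW c0) //.
  rewrite -Rintegral_itv_bndo_bndc; last exact: integrableS ig0.
  rewrite -[RHS](cutoff_integral_itv_eq0 ig c0 dp) //.
    apply: eq_Rintegral => x; rewrite inE /= in_itv /= => /andP[cx xd].
    rewrite patchE mem_set // /I2pi /= in_itv /=.
    by rewrite (ltW (lt_trans c0 cx)) (ltW (lt_trans xd dp)).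
  by move=> n; apply: h.
have Fc (x y : R) : 0 < x < 2 * pi -> 0 < y < 2 * pi -> F x = F y.
  move=> /andP[x0 xp] /andP[y0 yp].
  by have [xy|/ltW yx] := leP x y; [|apply/esym]; exact: Fle.
have := @FTC1 R (g \_ I2pi) (BLeft 0) (igS _) (integrable_locally mI ig).
apply: (@filterS _ _ (ae_filter_ringOfSetsType mu)) => x /= FTC xI.
have [x0 xp] := andP xI.
have [_] := FTC x0; rewrite patchE mem_set; last first.
  by rewrite /I2pi /= in_itv /= (ltW x0) (ltW xp).
move=> <-; rewrite derive1E -/F.
suff : is_derive x 1 F 0 by case.
apply: (@near_eq_is_derive _ _ _ (cst (F x))).
near=> y; apply: Fc => //; apply/andP; split; near: y.
  exact: lt_nbhsr.
exact: lt_nbhsl.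
Unshelve. all: by end_near. Qed.

End Cutoff.

(** * Continuous functions and test functions on the interval *)

Section Calculus.
Variable R : realType.
Implicit Types (f g h u phi : R -> R).
Local Notation mu := (@lebesgue_measure R).

Lemma pi2_gt0 : 0 < 2 * pi :> R.
Proof. by rewrite mulr_gt0 ?pi_gt0. Qed.

Lemma in_I2pi (x : R) : I2pi x = (0 <= x <= 2 * pi).
Proof. by rewrite /I2pi /= in_itv. Qed.

Lemma measurable_I2pi : measurable (@I2pi R).
Proof. exact: measurable_itv. Qed.

Lemma is_derive_continuous f (x df : R) : is_derive x 1 f df ->
  {for x, continuous f}.
Proof. by case=> /derivable1_diffP/differentiable_continuous. Qed.

Lemma is_derive_continuousT f f' : (forall x : R, is_derive x 1 f (f' x)) ->
  continuous f.
Proof. by move=> h x; apply: is_derive_continuous (h x). Qed.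

Lemma integrable_continuous f : {within I2pi, continuous f} ->
  mu.-integrable I2pi (EFin \o f).
Proof. by move=> cf; apply: continuous_compact_integrable => //; exact: segment_compact. Qed.

(** Composition with clamp extends a function on the interval by constants; the
    extension of a continuous function is continuous on the whole line, so that
    two-sided derivatives of its primitives exist at the endpoints as well. *)
Definition clamp (x : R) : R := Num.max 0 (Num.min x (2 * pi)).

Lemma clamp_I2pi x : I2pi (clamp x).
Proof.
by rewrite in_I2pi /clamp le_max lexx /= ge_max (ltW pi2_gt0) ge_min lexx orbT.
Qed.

Lemma clamp_id x : I2pi x -> clamp x = x.
Proof. by rewrite in_I2pi => /andP[x0 xp]; rewrite /clamp min_l // max_r. Qed.

Lemma continuous_clamp : continuous clamp.
Proof.
move=> x; have h : {for x, continuous ((id : R -> R^o) \min cst (2 * pi))}.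
  by apply: continuous_min; [exact: cvg_id|exact: cvg_cst].
have h0 : {for x, continuous (cst 0 : R -> R^o)} by exact: cvg_cst.
have H := continuous_max h0 h; exact: H.
Qed.

Lemma continuous_extend (T : topologicalType) (f : R -> T) :
  {within I2pi, continuous f} -> continuous (f \o clamp).
Proof.
move=> /subspace_continuousP cf x.
apply: (@cvg_comp _ _ _ clamp f (nbhs x) (within I2pi (nbhs (clamp x))));
  last exact: cf (clamp_I2pi x).
move=> A.
rewrite /within /= => h.
have hh : \forall y \near x, I2pi (clamp y) -> A (clamp y).
  exact: (continuous_clamp h).
apply: filterS hh => y; apply; exact: clamp_I2pi.
Qed.

(** The primitive is needed on the whole line, while integrals have a fixed lower
    bound; taking the lower bound below both 0 and x, and subtracting the value
    at 0, makes the choice of the bound irrelevant. *)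
Lemma continuous_primitive g : continuous g ->
  exists G : R -> R, forall x : R, is_derive x 1 G (g x).
Proof.
move=> cg.
have ig (a b : R) : mu.-integrable `[a, b] (EFin \o g).
  apply: continuous_compact_integrable; first exact: segment_compact.
  exact: continuous_subspaceT.
pose P (N x : R) := \int[mu]_(t in `[- N, x]) g t.
have PB (N x y : R) : - N <= x -> x <= y ->
    P N y - P N x = \int[mu]_(t in `]x, y]) g t.
  by move=> Nx xy; rewrite /P Rintegral_itvB ?bnd_simp.
have PE (M N x : R) : 0 <= M -> 0 <= N -> - M <= x -> - N <= x ->
    P M x - P M 0 = P N x - P N 0.
  move=> M0 N0 Mx Nx; have [x0|/ltW x0] := leP 0 x.
    by rewrite !PB ?oppr_le0.
  by apply: oppr_inj; rewrite !opprB !PB.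
exists (fun x => P (`|x| + 1) x - P (`|x| + 1) 0) => x.
pose N := `|x| + 1.
have N0 : 0 <= N by rewrite addr_ge0.
have Nx : - N < x.
  by rewrite ltrNl /N (le_lt_trans (ler_norm _)) // normrN ltrDl.
apply: (@near_eq_is_derive _ _ _ (fun y => P N y - P N 0)).
  near=> y; apply: PE; rewrite ?addr_ge0 //.
    by apply: ltW; near: y; exact: lt_nbhsr.
  by rewrite lerNl (le_trans (ler_norm _)) // normrN lerDl.
rewrite -[g x]subr0; apply: is_derive_fB.
have [dP P'] := @continuous_FTC1_closed R g (- N) x (x + 1) (ltr_pwDr ltr01 (lexx _))
  (ig _ _) Nx (cg x).
by apply: DeriveDef => //; rewrite -derive1E.
Unshelve. all: by end_near. Qed.

Lemma derivable_oo_LRcontinuousP f f' (a b : R) : a < b ->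
  {within `[a, b], continuous f} ->
  (forall x : R, a < x < b -> is_derive x 1 f (f' x)) ->
  derivable_oo_LRcontinuous f a b /\ {in `]a, b[, derive1 f =1 f'}.
Proof.
move=> ab /(continuous_within_itvP _ ab)[_ ca cb] df; split; last first.
  by move=> x; rewrite in_itv /= => /df[_ <-]; rewrite derive1E.
by split=> // x; rewrite in_itv /= => /df[].
Qed.

(** Outside the open interval, so in particular at the two endpoints. *)
Lemma test_near0 phi (x : R) : test_function phi -> ~~ (0 < x < 2 * pi) ->
  \forall y \near x, phi y = 0.
Proof.
move=> [_ supp] nx; apply: contrapT => h; move/negP: nx; apply.
have : closure [set y | phi y != 0] x.
  move=> B Bx; apply: contrapT => hB; apply: h.
  apply: filterS Bx => y By; apply/eqP; rewrite -[_ == _]negbK; apply/negP => ny.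
  by apply: hB; exists y.
by move=> /supp; rewrite /= in_itv.
Qed.

Lemma test_boundary phi (x : R) : test_function phi -> ~~ (0 < x < 2 * pi) ->
  phi x = 0.
Proof. by move=> tphi nx; apply: nbhs_singleton (test_near0 tphi nx). Qed.

Lemma test_derivable phi : test_function phi -> forall x : R, is_derive x 1 phi (derive1 phi x).
Proof. by move=> [d _] x; rewrite derive1E; apply/derivableP; exact: (d 0%N). Qed.

Lemma test_derive1 phi : test_function phi -> test_function (derive1 phi).
Proof.
move=> [d supp]; split=> [n x|].
  by have := d n.+1 x; rewrite /derive1n iterSr.
apply: subset_trans supp; apply: subset_trans (@closed_closure _ _).
apply: closure_subset => x /= nx B Bx.
apply: contrapT => hB; move/eqP: nx; apply.
have : is_derive x 1 phi 0.
  apply: (@near_eq_is_derive _ _ _ (cst 0)).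
  apply: filterS Bx => y By; apply/esym/eqP; rewrite -[_ == _]negbK.
  by apply/negP => ny; apply: hB; exists y.
by move=> [_]; rewrite derive1E.
Qed.

Lemma test_derive1n n phi : test_function phi -> test_function (derive1n n phi).
Proof. by elim: n phi => // n IH phi /IH; exact: test_derive1. Qed.

Lemma continuous_test phi : test_function phi -> continuous phi.
Proof. by move=> /test_derivable; exact: is_derive_continuousT. Qed.

(** The boundary terms vanish with the test function. *)
Lemma integration_by_parts_test u u' : {within I2pi, continuous u} ->
  {within I2pi, continuous u'} ->
  (forall x : R, 0 < x < 2 * pi -> is_derive x 1 u (u' x)) ->
  forall phi, test_function phi ->
    \int[mu]_(x in I2pi) (u x * derive1 phi x) =
    - \int[mu]_(x in I2pi) (u' x * phi x).
Proof.
move=> cu cu' du phi tphi.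
have cT h : test_function h -> {within `[0, 2 * pi], continuous h}.
  by move=> th; apply: continuous_subspaceT; exact: continuous_test.
have [Du uE] := derivable_oo_LRcontinuousP pi2_gt0 cu du.
have [Dp pE] := derivable_oo_LRcontinuousP pi2_gt0 (cT _ tphi)
  (fun x _ => test_derivable tphi x).
rewrite (@Rintegration_by_parts R u phi u' _ _ _ pi2_gt0) //; last first.
  exact/cT/test_derive1.
by rewrite !(test_boundary tphi) ?ltxx ?andbF // !mulr0 subrr sub0r.
Qed.

End Calculus.

(** * Functions with zero weak derivative *)

Section DuBoisReymond.
Variable R : realType.
Implicit Types (f g h u phi : R -> R).
Local Notation mu := (@lebesgue_measure R).

Lemma derive0_cst f (a b : R) : {within `[a, b], continuous f} ->
  (forall x : R, a < x < b -> is_derive x 1 f 0) ->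
  forall x y, a <= x <= b -> a <= y <= b -> f x = f y.
Proof.
move=> cf df; have le (x y : R) : a <= x -> x <= y -> y <= b -> f x = f y.
  move=> ax xy yb; apply/esym/eqP; rewrite -subr_eq0.
  have [||c _ ->] := @MVT_segment R f (cst 0) x y xy; last by rewrite mul0r.
    move=> z; rewrite in_itv /= => /andP[xz zy]; apply: df.
    by rewrite (le_lt_trans ax xz) (lt_le_trans zy yb).
  apply: continuous_subspaceW cf => z; rewrite /= !in_itv /= => /andP[xz zy].
  by rewrite (le_trans ax xz) (le_trans zy yb).
move=> x y /andP[ax xb] /andP[ay yb].
by have [xy|/ltW yx] := leP x y; [|apply/esym]; exact: le.
Qed.

Lemma FTC2_I2pi f f' : {within I2pi, continuous f} ->
  {within I2pi, continuous f'} ->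
  (forall x : R, 0 < x < 2 * pi -> is_derive x 1 f (f' x)) ->
  \int[mu]_(x in I2pi) f' x = f (2 * pi) - f 0.
Proof.
move=> cf cf' df.
have [Df fE] := derivable_oo_LRcontinuousP (pi2_gt0 R) cf df.
by rewrite /Rintegral (continuous_FTC2 (pi2_gt0 R) cf' Df fE).
Qed.

Lemma integral_lincomb f g (k : R) : {within I2pi, continuous f} ->
  {within I2pi, continuous g} ->
  \int[mu]_(x in I2pi) (f x - k * g x) =
  \int[mu]_(x in I2pi) f x - k * \int[mu]_(x in I2pi) g x.
Proof.
move=> cf cg; rewrite RintegralB; first by rewrite RintegralZl //;
  [exact: measurable_I2pi|exact: integrable_continuous].
- exact: measurable_I2pi.
- exact: integrable_continuous.
- by apply: integrable_continuous => x; apply: cvgMl_tmp; exact: cg.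
Qed.

Lemma continuous_cutoff (c d k : R) : continuous (cutoff c d k).
Proof.
move=> x; apply: differentiable_continuous; apply/derivable1_diffP.
by have [] := cutoff_ndiff c d k 1.
Qed.

(** The primitive is nondecreasing and, by the mean value theorem, strictly
    larger at d than at c. *)
Lemma integral_cutoff_gt0 (c d k : R) : 0 < k -> 0 < c -> c < d ->
  d < 2 * pi -> 0 < \int[mu]_(x in I2pi) cutoff c d k x.
Proof.
move=> k0 c0 cd dp.
have cc : continuous (cutoff c d k) := @continuous_cutoff c d k.
have [G GE] := continuous_primitive cc.
have cG : continuous G := is_derive_continuousT GE.
rewrite (FTC2_I2pi (f := G)) //; first last.
- exact: continuous_subspaceT.
- exact: continuous_subspaceT.
have Gle (x y : R) : x <= y -> G x <= G y.
  move=> xy; rewrite -subr_ge0.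
  have [z _ ->] := MVT_segment xy (fun z _ => GE z) (continuous_subspaceT cG).
  by rewrite mulr_ge0 ?subr_ge0 // cutoff_ge0.
have [z] := MVT cd (fun z _ => GE z) (continuous_subspaceT cG).
rewrite in_itv /= => zcd Gcd.
have : 0 < G d - G c by rewrite Gcd mulr_gt0 ?subr_gt0 // cutoff_gt0.
have := Gle _ _ (ltW c0); have := Gle _ _ (ltW dp); lra.
Qed.

(** The primitive is constant on either side of [c, d], with the values that it
    has at the endpoints of the interval. *)
Lemma test_primitive phi chi (c d : R) : 0 < c -> d < 2 * pi ->
  (forall n, ndiff n phi) -> (forall x, phi x != 0 -> c <= x <= d) ->
  (forall x : R, is_derive x 1 chi (phi x)) -> chi 0 = 0 -> chi (2 * pi) = 0 ->
  test_function chi.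
Proof.
move=> c0 dp nphi supp dchi chi0 chip.
have cchi : continuous chi := is_derive_continuousT dchi.
apply: (@supported_test_function _ _ c d) => // [n|x nx].
  case: n => // n; split; first by move=> x; have [] := dchi x.
  by rewrite (derive1_is_derive dchi).
have phi0 y : ~~ (c <= y <= d) -> phi y = 0.
  by move=> ny; apply/eqP; rewrite -[_ == _]negbK; apply: contra ny; exact: supp.
rewrite !leNgt; apply/andP; split; apply/negP => h; move/eqP: nx; apply.
  rewrite -chi0; apply: (@derive0_cst _ (Num.min x 0) c).
  - exact: continuous_subspaceT.
  - move=> y /andP[_ yc]; have := dchi y; rewrite phi0 //.
    by rewrite [c <= y]leNgt yc.
  - by rewrite ge_min lexx (ltW h).
  - by rewrite ge_min lexx orbT (ltW c0).
rewrite -chip; apply: (@derive0_cst _ d (Num.max x (2 * pi))).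
- exact: continuous_subspaceT.
- move=> y /andP[dy _]; have := dchi y; rewrite phi0 //.
  by rewrite [y <= d]leNgt dy andbF.
- by rewrite le_max lexx (ltW h).
- by rewrite le_max lexx orbT (ltW dp).
Qed.

(** Fix a cutoff psi. For each cutoff phi, subtract the multiple m psi with the
    same integral as phi: the difference is the derivative of a test function,
    so that g integrates to zero against it. Therefore g - C integrates to zero
    against all cutoffs, C being the psi-average of g. *)
Lemma weak_derive0_cst g : {within I2pi, continuous g} ->
  (forall phi, test_function phi ->
     \int[mu]_(x in I2pi) (g x * derive1 phi x) = 0) ->
  exists C, forall x, 0 < x < 2 * pi -> g x = C.
Proof.
move=> cg hg.
have p0 := pi_gt0 R.
pose psi := cutoff (pi / 2) pi 1 : R -> R.
pose I f := \int[mu]_(x in I2pi) f x.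
have Ipsi : 0 < I psi by apply: integral_cutoff_gt0 => //; lra.
pose C := I (g \* psi) / I psi.
have cT f : continuous f -> {within I2pi, continuous f}.
  by move=> cf; exact: continuous_subspaceT.
have cgC : {within I2pi, continuous (fun x => g x - C)}.
  by move=> x; apply: cvgB; [exact: cg|exact: cvg_cst].
have cutoff0 (c d : R) n : 0 < c -> d < 2 * pi ->
    I ((fun x => g x - C) \* cutoff c d n.+1%:R) = 0.
  move=> c0 dp; set phi := cutoff c d n.+1%:R.
  have cphi : continuous phi by exact: continuous_cutoff.
  have cpsi : continuous psi by exact: continuous_cutoff.
  pose m := I phi / I psi.
  pose eta x := phi x - m * psi x.
  have neta k : ndiff k eta.
    rewrite (_ : eta = phi + cst (- m) * psi); last first.
      by apply/funext => x; rewrite /eta !fctE mulNr.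
    apply: ndiffD; first exact: cutoff_ndiff.
    by apply: ndiffM; [exact: ndiff_cst|exact: cutoff_ndiff].
  have ceta : continuous eta.
    by move=> x; apply: cvgB; [exact: cphi|apply: cvgMl_tmp; exact: cpsi].
  have Ieta : I eta = 0.
    rewrite /I /eta integral_lincomb; [|exact: cT..].
    by rewrite -/(I psi) -/(I phi) /m divfK ?subrr // gt_eqF.
  have [chi0 dchi0] := continuous_primitive ceta.
  pose chi x := chi0 x - chi0 0.
  have dchi (x : R) : is_derive x 1 chi (eta x).
    by rewrite -[eta x]subr0; apply: is_derive_fB.
  have chiz : chi 0 = 0 by rewrite /chi subrr.
  have chip : chi (2 * pi) = 0.
    have := FTC2_I2pi (cT _ (is_derive_continuousT dchi)) (cT _ ceta) (fun x _ => dchi x).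
    by rewrite -/(I eta) Ieta chiz subr0.
  have tchi : test_function chi.
    apply: (@test_primitive eta chi (Num.min c (pi / 2)) (Num.max d pi)) => //.
    - by rewrite lt_min c0; lra.
    - by rewrite gt_max dp; lra.
    move=> x; rewrite ge_min le_max => nx.
    have : (phi x != 0) || (psi x != 0).
      apply: contraNT nx; rewrite negb_or !negbK /eta => /andP[/eqP-> /eqP->].
      by rewrite mulr0 subrr.
    case/orP => nz.
      have : 0 < phi x by rewrite lt_neqAle eq_sym nz cutoff_ge0.
      by rewrite cutoff_gt0 // => /andP[/ltW-> /ltW->].
    have : 0 < psi x by rewrite lt_neqAle eq_sym nz cutoff_ge0.
    by rewrite cutoff_gt0 // => /andP[/ltW-> /ltW->]; rewrite !orbT.
  have := hg _ tchi; rewrite (derive1_is_derive dchi).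
  have cgM f : continuous f -> {within I2pi, continuous (g \* f)}.
    by move=> cf x; apply: continuousM; [exact: cg|exact: cT].
  rewrite (_ : \int[mu]_(x in _) _ =
      \int[mu]_(x in I2pi) ((g \* phi) x - m * (g \* psi) x)); last first.
    by apply: eq_Rintegral => x _ /=; rewrite /eta; move: (phi x) (psi x) => p q; ring.
  rewrite integral_lincomb; [|exact: cgM..] => E.
  rewrite (_ : I _ = \int[mu]_(x in I2pi) ((g \* phi) x - C * phi x)); last first.
    by apply: eq_Rintegral => x _ /=; rewrite mulrBl.
  rewrite integral_lincomb; [|exact: cgM|exact: cT].
  rewrite -E; congr (_ - _); rewrite -/(I phi) -/(I (g \* psi)) /C /m; ring.
have int0 (c d : R) : 0 < c -> d < 2 * pi -> \int[mu]_(x in `]c, d[) (g x - C) = 0.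
  move=> c0 dp; apply: cutoff_integral_itv_eq0 => //.
    exact: integrable_continuous.
  by move=> n; exact: cutoff0.
exists C.
(* The primitive of the continuous function g - C is constant. *)
have cext := continuous_extend cgC.
have [G dG] := continuous_primitive cext.
have cG := is_derive_continuousT dG.
have Glt (c d : R) : 0 < c -> c < d -> d < 2 * pi -> G c = G d.
  move=> c0 cd dp.
  have [DG GE] := derivable_oo_LRcontinuousP cd (continuous_subspaceT cG) (fun x _ => dG x).
  have := continuous_FTC2 cd (continuous_subspaceT cext) DG GE.
  move=> /(congr1 fine); rewrite -/(Rintegral _ _ _) /=.
  have ic (a b : itv_bound R) : [set` Interval a b] `<=` `[c, d] ->
      mu.-integrable [set` Interval a b] (EFin \o ((fun x => g x - C) \o @clamp R)).
    move=> h; apply: (@integrableS _ _ _ mu `[c, d]%classic) => //.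
    apply: continuous_compact_integrable; first exact: segment_compact.
    exact: continuous_subspaceT.
  rewrite -Rintegral_itv_bndo_bndc; last first.
    by apply: ic => x /=; rewrite !in_itv /= => /andP[-> /ltW].
  rewrite -Rintegral_itv_obnd_cbnd; last first.
    by apply: ic => x /=; rewrite !in_itv /= => /andP[/ltW -> /ltW].
  rewrite (_ : Rintegral _ _ _ = 0) => [E|]; first by lra.
  rewrite -[RHS](int0 c d) //; apply: eq_Rintegral => x.
  rewrite inE /= in_itv /= => xcd; rewrite clamp_id // in_I2pi; lra.
have Gc (x y : R) : 0 < x < 2 * pi -> 0 < y < 2 * pi -> G x = G y.
  move=> /andP[x0 xp] /andP[y0 yp].
  have [xy|yx|-> //] := ltgtP x y; first exact: Glt.
  by apply/esym; exact: Glt.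
move=> x xI; have [x0 xp] := andP xI.
have : is_derive x 1 G 0.
  apply: (@near_eq_is_derive _ _ _ (cst (G x))).
  near=> y; apply: Gc => //; apply/andP; split; near: y.
    exact: lt_nbhsr.
  exact: lt_nbhsl.
move=> [_]; have [_ ->] := dG x; rewrite /= clamp_id; first by lra.
by rewrite in_I2pi (ltW x0) (ltW xp).
Unshelve. all: by end_near. Qed.


End DuBoisReymond.

(** * Real weak derivatives and the energy identity *)

Section RealUniqueness.
Variable R : realType.
Implicit Types (f g h u v phi : R -> R).
Local Notation mu := (@lebesgue_measure R).

Definition rweak (n : nat) u v := forall phi, test_function phi ->
  \int[mu]_(x in I2pi) (u x * derive1n n phi x) =
  (-1) ^+ n * \int[mu]_(x in I2pi) (v x * phi x).

Lemma withinD f g : {within I2pi, continuous f} ->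
  {within I2pi, continuous g} -> {within I2pi, continuous (fun x => f x + g x)}.
Proof. by move=> cf cg x; apply: cvgD; [exact: cf|exact: cg]. Qed.

Lemma withinB f g : {within I2pi, continuous f} ->
  {within I2pi, continuous g} -> {within I2pi, continuous (fun x => f x - g x)}.
Proof. by move=> cf cg x; apply: cvgB; [exact: cf|exact: cg]. Qed.

Lemma withinM f g : {within I2pi, continuous f} ->
  {within I2pi, continuous g} -> {within I2pi, continuous (fun x => f x * g x)}.
Proof. by move=> cf cg x; apply: continuousM; [exact: cf|exact: cg]. Qed.

Lemma within_cst (c : R) : {within I2pi, continuous (fun _ : R => c)}.
Proof. by move=> x; exact: cvg_cst. Qed.

(** Derivatives of test functions are test functions: this passes from the n-th
    weak derivatives of u to first weak derivatives of continuous functions. *)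
Lemma rweak_step n u v v' : rweak n u v -> rweak n.+1 u v' -> rweak 1 v v'.
Proof.
move=> w w' phi tphi; have := w' _ tphi.
have := w _ (test_derive1 tphi); rewrite /derive1n -iterSr => -> /eqP.
rewrite exprSr -mulrA.
by rewrite (inj_eq (mulfI _)) ?signr_eq0 // expr1 => /eqP.
Qed.

Lemma rweak_classical (u : nat -> R -> R) n :
  (forall k, (k <= n)%N -> {within I2pi, continuous (u k)}) ->
  (forall k, (k < n)%N -> forall x : R, 0 < x < 2 * pi ->
     is_derive x 1 (u k) (u k.+1 x)) ->
  rweak n (u 0%N) (u n).
Proof.
elim: n u => [|n IH] u cu du phi tphi; first by rewrite expr0 mul1r.
rewrite derive1nS (integration_by_parts_test (cu 0%N isT) (cu 1%N isT) (du 0%N isT)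
  (test_derive1n n tphi)).
have -> := IH (fun k => u k.+1) (fun k => cu k.+1) (fun k => du k.+1) _ tphi.
by rewrite exprS mulN1r mulNr.
Qed.

(** A primitive H of h has the same weak derivative as g, hence g - H is
    constant. *)
Lemma du_bois_reymond g h : {within I2pi, continuous g} ->
  {within I2pi, continuous h} -> rweak 1 g h ->
  forall x : R, 0 < x < 2 * pi -> is_derive x 1 g (h x).
Proof.
move=> cg ch wgh.
have [H dH] := continuous_primitive (continuous_extend ch).
have cH : {within I2pi, continuous H}.
  exact: continuous_subspaceT (is_derive_continuousT dH).
have dHI (x : R) : 0 < x < 2 * pi -> is_derive x 1 H (h x).
  move=> /andP[x0 xp]; have := dH x; rewrite /= clamp_id //.
  by rewrite in_I2pi (ltW x0) (ltW xp).
(* The factor 1 puts the difference in the form of integral_lincomb. *)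
have [C gC] : exists C, forall x, 0 < x < 2 * pi -> g x - 1 * H x = C.
  apply: weak_derive0_cst.
    by move=> x; apply: cvgB; [exact: cg|apply: cvgMl_tmp; exact: cH].
  move=> phi tphi.
  have cp : {within I2pi, continuous (derive1 phi)}.
    exact: continuous_subspaceT (continuous_test (test_derive1 tphi)).
  rewrite (_ : \int[mu]_(x in _) _ = \int[mu]_(x in I2pi)
      (g x * derive1 phi x - 1 * (H x * derive1 phi x))); last first.
    by apply: eq_Rintegral => x _; rewrite mulrBl mulrA.
  rewrite integral_lincomb; first last.
  - by move=> x; apply: continuousM; [exact: cH|exact: cp].
  - by move=> x; apply: continuousM; [exact: cg|exact: cp].
  rewrite (integration_by_parts_test cH ch dHI tphi).
  by have := wgh _ tphi; rewrite expr1 mulN1r mul1r => ->; rewrite subrr.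
move=> x xI; have [x0 xp] := andP xI.
rewrite -[h x]add0r.
apply: (@near_eq_is_derive _ _ _ (fun y => C + H y)).
  near=> y; have : 0 < y < 2 * pi.
    by apply/andP; split; near: y; [exact: lt_nbhsr|exact: lt_nbhsl].
  by move=> /gC <-; rewrite mul1r subrK.
by apply: is_derive_fD; exact: dHI.
Unshelve. all: by end_near. Qed.

Lemma ae_I2pi (P : R -> Prop) : {ae mu, forall x, 0 < x < 2 * pi -> P x} ->
  {ae mu, forall x, I2pi x -> P x}.
Proof.
have n1 (a : R) : {ae mu, forall x, x != a}.
  exists [set a]; split=> [||x /= /negP]; first exact: measurable_set1.
    exact: lebesgue_measure_set1.
  by rewrite negbK => /eqP.
move=> h; have F := ae_filter_ringOfSetsType mu.
apply: (@filterS3 _ _ F) h (n1 0) (n1 (2 * pi)) => x h x0 xp.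
rewrite in_I2pi !le_eqVlt [0 == x]eq_sym (negbTE x0) (negbTE xp) /=; exact: h.
Qed.

Lemma rweak0_ae u v : mu.-integrable I2pi (EFin \o u) ->
  mu.-integrable I2pi (EFin \o v) -> rweak 0 u v ->
  {ae mu, forall x, I2pi x -> u x = v x}.
Proof.
move=> iu iv w; apply: ae_I2pi.
have iuv : mu.-integrable I2pi (EFin \o (u \- v)).
  rewrite (_ : _ \o _ = (EFin \o u) \- (EFin \o v))%E //.
  by apply: integrableB => //; exact: measurable_I2pi.
suff h : {ae mu, forall x, 0 < x < 2 * pi -> (u \- v) x = 0}.
  apply: (@filterS _ _ (ae_filter_ringOfSetsType mu)) h => x h /h /eqP.
  by rewrite subr_eq0 => /eqP.
apply: cutoff_fundamental => // c d n c0 dp; have := w _ (test_cutoff (ltr0Sn _ n) c0 dp).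
rewrite expr0 mul1r /derive1n /= => E.
under eq_Rintegral do rewrite mulrBl.
have ib g : mu.-integrable I2pi (EFin \o g) ->
   mu.-integrable I2pi (EFin \o (g \* cutoff c d n.+1%:R)).
  move=> ig; apply: integrable_bounded_mul => //.
  - exact: measurable_I2pi.
  - exact: measurable_cutoff.
  - exact: norm_cutoff_le1.
rewrite RintegralB; first by rewrite E subrr.
- exact: measurable_I2pi.
- exact: ib.
- exact: ib.
Qed.

Lemma derive_interior_eq0 f (d : R) (a b x : R) : a < x < b ->
  (forall y, a < y < b -> f y = f x) -> is_derive x 1 f d -> d = 0.
Proof.
move=> /andP[ax xb] fE [_ <-].
have [_ -> //] : is_derive x 1 f 0.
apply: (@near_eq_is_derive _ _ _ (cst (f x))).
near=> y; apply/esym/fE; apply/andP.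
by split; near: y; [exact: lt_nbhsr|exact: lt_nbhsl].
Unshelve. all: by end_near. Qed.

(** The four functions w 0, ..., w 3 are a periodic solution of the homogeneous
    equation together with its derivatives. *)
Section Energy.
Variables (a b : R) (b_neq0 : b != 0) (w : nat -> R -> R).
Hypothesis cw : forall k, (k < 4)%N -> {within I2pi, continuous (w k)}.
Hypothesis pw : forall k, (k < 4)%N -> w k 0 = w k (2 * pi).
Hypothesis dw : forall k, (k < 3)%N -> forall x : R, 0 < x < 2 * pi ->
  is_derive x 1 (w k) (w k.+1 x).
Hypothesis dw3 : forall x : R, 0 < x < 2 * pi ->
  is_derive x 1 (w 3%N) (w 2%N x + b * w 1%N x + a * w 0%N x).

(** The energy is multiplied by b so that its derivative (b w')^2 is nonnegative
    whatever the sign of b. *)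
Lemma energy_derive0 (x : R) : 0 < x < 2 * pi -> w 1%N x = 0.
Proof.
pose E x := b * (w 3%N x * w 1%N x -
   2^-1 * (w 2%N x * w 2%N x + (w 1%N x * w 1%N x + a * (w 0%N x * w 0%N x)))).
have dE (y : R) : 0 < y < 2 * pi -> is_derive y 1 E ((b * w 1%N y) ^+ 2).
  move=> yI; have d0 := dw (k := 0) isT yI; have d1 := dw (k := 1) isT yI.
  have d2 := dw (k := 2) isT yI; have d3 := dw3 yI.
  apply: (is_derive_eq (is_derive_fcM b (is_derive_fB (is_derive_fM d3 d1)
    (is_derive_fcM 2^-1 (is_derive_fD (is_derive_fM d2 d2)
      (is_derive_fD (is_derive_fM d1 d1) (is_derive_fcM a (is_derive_fM d0 d0)))))))).
  by field.
have cE : {within I2pi, continuous E}.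
  apply: withinM; first exact: within_cst.
  apply: withinB; first by apply: withinM; exact: cw.
  apply: withinM; first exact: within_cst.
  apply: withinD; first by apply: withinM; exact: cw.
  apply: withinD; first by apply: withinM; exact: cw.
  by apply: withinM; [exact: within_cst|apply: withinM; exact: cw].
have Ele (y z : R) : 0 <= y -> y <= z -> z <= 2 * pi -> E y <= E z.
  move=> y0 yz zp; rewrite -subr_ge0.
  have [||t _ ->] := @MVT_segment R E (fun y => (b * w 1%N y) ^+ 2) y z yz.
  - move=> t; rewrite in_itv /= => /andP[yt tz]; apply: dE.
    by rewrite (le_lt_trans y0 yt) (lt_le_trans tz zp).
  - apply: continuous_subspaceW cE => t; rewrite /= in_I2pi in_itv /=.
    by move=> /andP[yt tz]; rewrite (le_trans y0 yt) (le_trans tz zp).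
  - by rewrite mulr_ge0 ?sqr_ge0 ?subr_ge0.
have E0p : E 0 = E (2 * pi) by rewrite /E !pw.
have Ec (y : R) : 0 < y < 2 * pi -> E y = E 0.
  move=> /andP[/ltW y0 /ltW yp]; apply/le_anti/andP; split.
    by rewrite E0p; exact: Ele.
  by apply: Ele => //.
move=> xI; have /eqP := derive_interior_eq0 xI
  (fun y yI => etrans (Ec y yI) (esym (Ec x xI))) (dE x xI).
by rewrite sqrf_eq0 mulf_eq0 (negbTE b_neq0) => /eqP.
Qed.

Lemma energy_zero_order (x : R) : 0 < x < 2 * pi -> a * w 0%N x = 0.
Proof.
have z1 (y : R) : 0 < y < 2 * pi -> w 1%N y = 0 := @energy_derive0 y.
have z2 (y : R) : 0 < y < 2 * pi -> w 2%N y = 0.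
  move=> yI; apply: (derive_interior_eq0 yI _ (dw (k := 1) isT yI)).
  by move=> z zI; rewrite !z1.
have z3 (y : R) : 0 < y < 2 * pi -> w 3%N y = 0.
  move=> yI; apply: (derive_interior_eq0 yI _ (dw (k := 2) isT yI)).
  by move=> z zI; rewrite !z2.
move=> xI; have : w 2%N x + b * w 1%N x + a * w 0%N x = 0.
  apply: (derive_interior_eq0 xI _ (dw3 xI)).
  by move=> z zI; rewrite !z3.
by rewrite z1 // z2 // mulr0 !add0r.
Qed.

End Energy.
End RealUniqueness.

(** * Periodic solutions of factored linear equations *)

Section ComplexCalculus.
Variable R : realType.
Implicit Types (f g u v : R -> R[i]) (z : R[i]).
Local Notation Re := complex.Re.
Local Notation Im := complex.Im.

Lemma ReD (x y : R[i]) : Re (x + y) = Re x + Re y.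
Proof. by case: x y => [? ?] [? ?]. Qed.
Lemma ImD (x y : R[i]) : Im (x + y) = Im x + Im y.
Proof. by case: x y => [? ?] [? ?]. Qed.
Lemma ReB (x y : R[i]) : Re (x - y) = Re x - Re y.
Proof. by case: x y => [? ?] [? ?]. Qed.
Lemma ImB (x y : R[i]) : Im (x - y) = Im x - Im y.
Proof. by case: x y => [? ?] [? ?]. Qed.
Lemma ReN (x : R[i]) : Re (- x) = - Re x.
Proof. by case: x. Qed.
Lemma ImN (x : R[i]) : Im (- x) = - Im x.
Proof. by case: x. Qed.
Lemma ReM (x y : R[i]) : Re (x * y) = Re x * Re y - Im x * Im y.
Proof. by case: x y => [? ?] [? ?]. Qed.
Lemma ImM (x y : R[i]) : Im (x * y) = Re x * Im y + Im x * Re y.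
Proof. by case: x y => [? ?] [? ?]. Qed.
Lemma complexP (x y : R[i]) : Re x = Re y -> Im x = Im y -> x = y.
Proof. by case: x y => [? ?] [? ?] /= -> ->. Qed.

(** R[i] is a normed space over itself and not over R, so that the derivative of
    a function from R to R[i] is taken componentwise. *)
Definition is_cderive u v := forall x : R,
  is_derive x 1 (fun y => Re (u y)) (Re (v x)) /\
  is_derive x 1 (fun y => Im (u y)) (Im (v x)).

Definition ccontinuous u :=
  continuous (fun x => Re (u x)) /\ continuous (fun x => Im (u x)).

Lemma is_cderive_continuous u v : is_cderive u v -> ccontinuous u.
Proof. by move=> d; split; apply: is_derive_continuousT => x; have [] := d x. Qed.

Lemma is_cderive_eq u v w : is_cderive u v -> v =1 w -> is_cderive u w.
Proof. by move=> d vw x; rewrite -vw. Qed.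

Lemma is_cderive_cst z : is_cderive (cst z) (cst 0).
Proof. by move=> x; split; exact: is_derive_cst. Qed.

Lemma is_cderiveD u u' v v' : is_cderive u u' -> is_cderive v v' ->
  is_cderive (u + v) (u' + v').
Proof.
move=> du dv x; have [ru iu] := du x; have [rv iv] := dv x; split.
  under eq_fun do rewrite ReD; rewrite ReD; exact: is_derive_fD.
under eq_fun do rewrite ImD; rewrite ImD; exact: is_derive_fD.
Qed.

Lemma is_cderiveM u u' v v' : is_cderive u u' -> is_cderive v v' ->
  is_cderive (u * v) (u' * v + u * v').
Proof.
move=> du dv x; have [ru iu] := du x; have [rv iv] := dv x; split.
  under eq_fun do rewrite ReM; rewrite ReD !ReM.
  apply: (is_derive_eq (is_derive_fB (is_derive_fM ru rv) (is_derive_fM iu iv))).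
  by rewrite addrACA -opprD.
under eq_fun do rewrite ImM; rewrite ImD !ImM.
apply: (is_derive_eq (is_derive_fD (is_derive_fM ru iv) (is_derive_fM iu rv))).
by rewrite addrACA.
Qed.

Lemma is_cderiveZ z u u' : is_cderive u u' -> is_cderive (cst z * u) (cst z * u').
Proof.
move=> du; apply: is_cderive_eq (is_cderiveM (is_cderive_cst z) du) _ => x.
by rewrite !fctE mul0r add0r.
Qed.

Lemma is_cderiveB u u' v v' : is_cderive u u' -> is_cderive v v' ->
  is_cderive (u - v) (u' - v').
Proof.
move=> du dv; rewrite -[v]mul1r -[v']mul1r -!mulNr.
apply: is_cderiveD => //; exact: (is_cderiveZ (-1)).
Qed.

Lemma is_cderive_sum n (u u' : nat -> R -> R[i]) :
  (forall k, (k < n)%N -> is_cderive (u k) (u' k)) ->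
  is_cderive (\sum_(k < n) u k) (\sum_(k < n) u' k).
Proof.
elim: n => [|n IH] du; first by rewrite !big_ord0; exact: is_cderive_cst.
rewrite !big_ord_recr /=; apply: is_cderiveD; last exact: du.
by apply: IH => k kn; apply: du; rewrite ltnS ltnW.
Qed.

Lemma ccontinuousM u v : ccontinuous u -> ccontinuous v -> ccontinuous (u * v).
Proof.
move=> [ru iu] [rv iv]; split=> x.
  under eq_fun do rewrite ReM.
  by apply: cvgB; apply: cvgM; [exact: ru|exact: rv|exact: iu|exact: iv].
under eq_fun do rewrite ImM.
by apply: cvgD; apply: cvgM; [exact: ru|exact: iv|exact: iu|exact: rv].
Qed.

Lemma ccontinuousD u v : ccontinuous u -> ccontinuous v -> ccontinuous (u + v).
Proof.
move=> [ru iu] [rv iv]; split=> x.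
  under eq_fun do rewrite ReD.
  by apply: cvgD; [exact: ru|exact: rv].
under eq_fun do rewrite ImD.
by apply: cvgD; [exact: iu|exact: iv].
Qed.

Lemma ccontinuousB u v : ccontinuous u -> ccontinuous v -> ccontinuous (u - v).
Proof.
move=> [ru iu] [rv iv]; split=> x.
  under eq_fun do rewrite ReB.
  by apply: cvgB; [exact: ru|exact: rv].
under eq_fun do rewrite ImB.
by apply: cvgB; [exact: iu|exact: iv].
Qed.

Lemma ccontinuous_cst z : ccontinuous (cst z).
Proof. by split=> x; exact: cvg_cst. Qed.

Lemma ccontinuous_sum n (u : nat -> R -> R[i]) :
  (forall k, (k < n)%N -> ccontinuous (u k)) -> ccontinuous (\sum_(k < n) u k).
Proof.
elim: n => [|n IH] cu; first by rewrite big_ord0; exact: ccontinuous_cst.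
rewrite big_ord_recr /=; apply: ccontinuousD; last exact: cu.
by apply: IH => k kn; apply: cu; rewrite ltnS ltnW.
Qed.

Lemma ccontinuous_primitive g : ccontinuous g -> exists G, is_cderive G g.
Proof.
move=> [/continuous_primitive[G1 d1] /continuous_primitive[G2 d2]].
by exists (fun x => Complex (G1 x) (G2 x)) => x; split; [exact: d1|exact: d2].
Qed.

Definition cexp z (x : R) : R[i] :=
  Complex (expR (Re z * x) * cos (Im z * x)) (expR (Re z * x) * sin (Im z * x)).

Lemma is_cderive_cexp z : is_cderive (cexp z) (cst z * cexp z).
Proof.
move=> x; have dl (c : R) : is_derive x 1 (fun y : R => c * y) c.
  by rewrite -[X in is_derive _ _ _ X]mulr1; apply: is_derive_fcM.
have de := is_derive_fcomp (is_derive_expR (Re z * x)) (dl (Re z)).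
have dc := is_derive_fcomp (is_derive_cos (Im z * x)) (dl (Im z)).
have ds := is_derive_fcomp (is_derive_sin (Im z * x)) (dl (Im z)).
split; rewrite ?ReM ?ImM /=.
  apply: (is_derive_eq (is_derive_fM de dc)); ring.
apply: (is_derive_eq (is_derive_fM de ds)); ring.
Qed.

Lemma cexp0 z : cexp z 0 = 1.
Proof. by rewrite /cexp !mulr0 expR0 cos0 sin0 mulr1 mulr0. Qed.

Lemma cexpN z x : cexp z x * cexp (- z) x = 1.
Proof.
have E : expR (Re z * x) * expR (- (Re z * x)) = 1 by rewrite expRxMexpNx_1.
have C := cos2Dsin2 (Im z * x).
rewrite /cexp ReN ImN !mulNr cosN sinN; set e := expR _ in E *; set e' := expR _ in E *.
set c := cos _ in C *; set s := sin _ in C *.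
apply: complexP; rewrite ?ReM ?ImM /=; last by ring.
by transitivity ((e * e') * (c ^+ 2 + s ^+ 2)); [ring|rewrite E C mulr1].
Qed.

Lemma cexp_neq0 z x : cexp z x != 0.
Proof. by apply/eqP => e0; have /eqP := cexpN z x; rewrite e0 mul0r eq_sym oner_eq0. Qed.

(** Variation of constants: the solutions of u' = z u + g are
    e^(z x) (c + G(x)) with G a primitive of e^(- z x) g, and the condition on z
    is what allows one to solve u(0) = u(2 pi) for c. *)
Lemma periodic_first_order z g : cexp z (2 * pi) != 1 -> ccontinuous g ->
  exists u, is_cderive u (cst z * u + g) /\ u 0 = u (2 * pi).
Proof.
move=> nz cg.
have [|G dG] := @ccontinuous_primitive (cexp (- z) * g).
  by apply: ccontinuousM => //; exact: is_cderive_continuous (is_cderive_cexp _).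
pose e := cexp z (2 * pi).
pose c := (e * G (2 * pi) - G 0) / (1 - e).
exists (cexp z * (cst c + G)); split.
  apply: is_cderive_eq (is_cderiveM (is_cderive_cexp z) (is_cderiveD (is_cderive_cst c) dG)) _ => x.
  by rewrite !fctE add0r [cexp z x * (_ * _)]mulrA cexpN mul1r mulrA.
rewrite !fctE cexp0 mul1r -/e; apply/eqP; rewrite -subr_eq0; apply/eqP.
have ne : 1 - e != 0 by rewrite subr_eq0 eq_sym.
by rewrite /c; field.
Qed.

(** Let q be the product of the X - z, z in s, and u k stand for the k-th
    derivative of u 0; the conclusion reads q(D) u = g with periodic boundary
    conditions. For a further factor, solve (D - z) w = g and then q(D) u = w.
    As q is monic, q(D) u = w expresses the last derivative of u by w and the
    lower ones, so that u is differentiable once more. *)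
Lemma solve_prod (s : seq R[i]) g : (forall z, z \in s -> cexp z (2 * pi) != 1) ->
  ccontinuous g -> let q := \prod_(z <- s) ('X - z%:P) in
  exists u : nat -> R -> R[i],
  [/\ forall k, (k < size s)%N -> is_cderive (u k) (u k.+1) /\ u k 0 = u k (2 * pi),
      ccontinuous (u (size s)) &
      forall x, \sum_(k < (size s).+1) q`_k * u k x = g x].
Proof.
elim: s g => [|z s IH] g ns cg q.
  exists (fun _ => g); split=> // x.
  by rewrite big_ord_recl big_ord0 addr0 /q big_nil coef1 mul1r.
have [|w [dw pw]] := @periodic_first_order z g _ cg; first by apply: ns; rewrite inE eqxx.
have cw := is_cderive_continuous dw.
have [y ys|u [du cu uE]] := IH w _ cw; first by apply: ns; rewrite inE ys orbT.
set p := \prod_(z <- s) _ in uE; set n := size s in du cu uE *.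
have sp : size p = n.+1 by rewrite size_prod_XsubC.
have pn : p`_n = 1.
  have := monic_prod_XsubC s predT id; rewrite monicE lead_coefE.
  by rewrite -/p sp => /eqP.
have unE : u n = w - \sum_(k < n) cst p`_k * u k.
  apply/funext => x; rewrite !fctE -uE big_ord_recr /= pn mul1r.
  by rewrite fct_sumE addrAC subrr add0r.
pose t := (cst z * w + g) - \sum_(k < n) cst p`_k * u k.+1.
pose v k := if k == n.+1 then t else u k.
have vE k : (k <= n)%N -> v k = u k.
  by move=> kn; rewrite /v; case: eqP => // e; rewrite e ltnn in kn.
have vS : v n.+1 = t by rewrite /v eqxx.
have dv k : (k < n.+1)%N -> is_cderive (v k) (v k.+1).
  rewrite ltnS leq_eqVlt => /predU1P[->|kn]; last first.
    by rewrite !vE //; [have [] := du k kn|exact: ltnW].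
  rewrite vS vE // unE; apply: is_cderiveB => //.
  apply: (@is_cderive_sum n (fun k => cst p`_k * u k) (fun k => cst p`_k * u k.+1)) => j jn.
  by apply: is_cderiveZ; have [] := du j jn.
exists v; split=> [k kn||x].
- split; first exact: dv.
  move: kn; rewrite ltnS leq_eqVlt => /predU1P[->|kn]; last first.
    by rewrite vE ?(ltnW kn) //; have [] := du k kn.
  rewrite vE // unE !fctE pw !fct_sumE; congr (_ - _); apply: eq_bigr => j _.
  by rewrite !fctE; have [_ ->] := du j (ltn_ord j).
- rewrite vS; apply: ccontinuousB.
    apply: ccontinuousD => //.
    by apply: ccontinuousM => //; exact: ccontinuous_cst.
  apply: (@ccontinuous_sum n (fun k => cst p`_k * u k.+1)) => k kn.
  apply: ccontinuousM; first exact: ccontinuous_cst.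
  have := kn; rewrite leq_eqVlt => /predU1P[->//|kn'].
  by have [/is_cderive_continuous] := du _ kn'.
rewrite big_cons -/p in q *.
have qE k : q`_k = (if k == 0%N then 0 else p`_k.-1) - z * p`_k.
  by rewrite /q mulrBl coefB coefXM coefCM.
have step : \sum_(k < n.+2) q`_k * v k x =
    \sum_(k < n.+1) p`_k * v k.+1 x - z * \sum_(k < n.+1) p`_k * v k x.
  under eq_bigr do rewrite qE mulrBl.
  rewrite sumrB; congr (_ - _).
    by rewrite big_ord_recl /= mul0r add0r.
  rewrite big_ord_recr /= -/n [p`_n.+1]nth_default ?sp // mulr0 mul0r addr0 mulr_sumr.
  by apply: eq_bigr => k _; rewrite mulrA.
rewrite -/n step; under [X in _ - z * X]eq_bigr => k _ do rewrite vE ?leq_ord //.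
rewrite uE big_ord_recr /= pn mul1r vS /t !fctE fct_sumE.
rewrite (eq_bigr (fun k : 'I_n => (cst p`_k * u k.+1) x)); last first.
  by move=> k _; rewrite vE.
ring.
Qed.

End ComplexCalculus.

(** * Existence of classical solutions *)

Section Existence.
Variable R : realType.
Implicit Types (f g u v : R -> R[i]) (z : R[i]).
Local Notation mu := (@lebesgue_measure R).
Local Notation Re := complex.Re.
Local Notation Im := complex.Im.

(** The real and the imaginary part under one name, since every argument below
    applies to both. *)
Definition part (t : bool) (z : R[i]) : R := if t then Re z else Im z.

Lemma partD t (x y : R[i]) : part t (x + y) = part t x + part t y.
Proof. by case: t; rewrite /part ?ReD ?ImD. Qed.
Lemma partB t (x y : R[i]) : part t (x - y) = part t x - part t y.
Proof. by case: t; rewrite /part ?ReB ?ImB. Qed.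
Lemma partZ t (r : R) (x : R[i]) : part t (r%:C%C * x) = r * part t x.
Proof. by case: t; rewrite /part ?ReM ?ImM /= mul0r ?subr0 ?addr0. Qed.
Lemma part_inj (x y : R[i]) : (forall t, part t x = part t y) -> x = y.
Proof. by move=> e; apply: complexP; [exact: (e true)|exact: (e false)]. Qed.

Lemma is_cderive_part u v t (x : R) : is_cderive u v ->
  is_derive x 1 (part t \o u) (part t (v x)).
Proof. by move=> d; have [] := d x; case: t. Qed.

Lemma continuous_part u t : ccontinuous u -> continuous (part t \o u).
Proof. by case: t => -[]. Qed.

Lemma part0 t : part t 0 = 0.
Proof. by case: t. Qed.

Lemma within_part u t : ccontinuous u ->
  {within I2pi, continuous (part t \o u)}.
Proof. by move=> cu; apply: continuous_subspaceT; exact: continuous_part. Qed.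

Lemma part_cintegral u t : part t (cintegral u) = \int[mu]_(x in I2pi) part t (u x).
Proof. by case: t. Qed.

Lemma integral_cst (c : R) : \int[mu]_(x in I2pi) c = c * (2 * pi).
Proof.
have d (x : R) : is_derive x 1 (fun y : R => c * y) c.
  by rewrite -[X in is_derive _ _ _ X]mulr1; apply: is_derive_fcM.
have -> := @FTC2_I2pi R _ (cst c)
  (continuous_subspaceT (is_derive_continuousT d)) (@within_cst R c) (fun x _ => d x).
by rewrite mulr0 subr0.
Qed.

Lemma cintegralB_cst u z : ccontinuous u ->
  cintegral (u - cst z) = cintegral u - (2 * pi)%:C%C * z.
Proof.
move=> cu; apply: part_inj => t.
rewrite partB partZ !part_cintegral mulrC -integral_cst.
rewrite -[X in _ = _ - X]mul1r -integral_lincomb; first last.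
- exact: within_cst.
- exact: within_part.
by apply: eq_Rintegral => x _; rewrite !fctE partB mul1r.
Qed.

Lemma partN t (x : R[i]) : part t (- x) = - part t x.
Proof. by rewrite -sub0r partB part0 sub0r. Qed.

(** If e^(2 pi z) = 1, then e^(z x) is a periodic solution of the homogeneous
    equation, and the energy identity forces its derivative z e^(z x) to
    vanish. *)
Lemma nonresonant (a b : R) z : b != 0 -> z != 0 ->
  z ^+ 4 = z ^+ 2 + b%:C%C * z + a%:C%C -> cexp z (2 * pi) != 1.
Proof.
move=> b0 z0 ze; apply/eqP => e1.
pose w k := cst (z ^+ k) * cexp z.
have dw k : is_cderive (w k) (w k.+1).
  apply: is_cderive_eq (is_cderiveZ _ (is_cderive_cexp z)) _ => x.
  by rewrite /w !fctE mulrA exprSr.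
have p0 : 0 < @pi R < 2 * pi.
  by have p := pi_gt0 R; apply/andP; split; lra.
suff : w 1%N (@pi R) = 0.
  by move/eqP; rewrite /w fctE mulf_eq0 expr1 (negbTE z0) (negbTE (cexp_neq0 _ _)).
apply: part_inj => t; rewrite part0.
apply: (@energy_derive0 R a b b0 (fun k => part t \o w k)) => //.
- move=> k _; apply: continuous_subspaceT; apply: continuous_part.
  exact: is_cderive_continuous (dw k).
- by move=> k _; rewrite /= /w !fctE cexp0 e1.
- by move=> k _ x _; exact: is_cderive_part.
- move=> x _; apply: (is_derive_eq (is_cderive_part t x (dw 3%N))).
  rewrite /= /w !fctE -!partZ -!partD ze; congr part; ring.
Qed.

(** solve_prod for a monic polynomial given by its coefficients, split over the
    algebraically closed field R[i]. *)
Lemma solve_monic (cs : seq R[i]) g : let P := Poly (rcons cs 1) in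
  (forall z, root P z -> cexp z (2 * pi) != 1) -> ccontinuous g ->
  exists u : nat -> R -> R[i],
  [/\ forall k, (k < size cs)%N -> is_cderive (u k) (u k.+1) /\ u k 0 = u k (2 * pi),
      ccontinuous (u (size cs)) &
      forall x, \sum_(k < size cs) cs`_k * u k x + u (size cs) x = g x].
Proof.
move=> P nP cg.
have PE : P = rcons cs 1 :> seq _.
  by rewrite /P (PolyK (c := 0)) // last_rcons oner_eq0.
have lP : lead_coef P = 1 by rewrite lead_coefE PE size_rcons nth_rcons ltnn eqxx.
have [s sE] := closed_field_poly_normal P; rewrite lP scale1r in sE.
have ss : size s = size cs.
  have := congr1 (fun p : {poly R[i]} => size p) sE.
  by rewrite size_prod_XsubC PE size_rcons => -[].
have [z zs|u [du cu uE]] := @solve_prod R s g _ cg.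
  by apply: nP; rewrite sE root_prod_XsubC.
exists u; rewrite -ss; split=> // x; rewrite -uE big_ord_recr /=.
rewrite -sE PE nth_rcons ss ltnn eqxx mul1r; congr (_ + _); apply: eq_bigr => k _.
by rewrite nth_rcons ltn_ord.
Qed.

(** Here u k stands for the k-th derivative of the solution u 0. *)
Definition classical_solution (a b : R) g (u : nat -> R -> R[i]) :=
  [/\ forall k, (k < 4)%N -> is_cderive (u k) (u k.+1) /\ u k 0 = u k (2 * pi),
      ccontinuous (u 4%N) &
      forall x, u 4%N x = g x + u 2%N x + b%:C%C * u 1%N x + a%:C%C * u 0%N x].

Lemma classical_solvable_pos (a b : R) g : b != 0 -> 0 < a -> ccontinuous g ->
  exists u : nat -> R -> R[i], classical_solution a b g u.
Proof.
move=> b0 a0 cg.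
have [z|u [du cu uE]] := @solve_monic [:: - a%:C%C; - b%:C%C; -1; 0] g _ cg.
  rewrite /root horner_Poly /= => /eqP zE; apply: (@nonresonant a b) => //.
    apply/eqP => z0; move: zE; rewrite z0 !mulr0 !add0r => /eqP.
    by rewrite oppr_eq0 (inj_eq (@complexI _)) gt_eqF.
  apply/eqP; rewrite -subr_eq0 -zE; apply/eqP; ring.
exists u; split=> // x; rewrite -uE /= !big_ord_recl big_ord0 /=; ring.
Qed.

(** The primitive G of g is periodic because g has mean zero, and the cubic
    X^3 - X - b can be inverted on it. The equation does not see constants when
    a = 0, so the mean of the solution can be subtracted. *)
Lemma classical_solvable_zero (b : R) g : b != 0 -> ccontinuous g ->
  cintegral g = 0 ->
  exists2 u : nat -> R -> R[i], classical_solution 0 b g u & cintegral (u 0%N) = 0.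
Proof.
move=> b0 cg ig.
have [G dG] := ccontinuous_primitive cg.
have cG := is_cderive_continuous dG.
have pG : G 0 = G (2 * pi).
  apply: part_inj => t; apply/esym/eqP; rewrite -subr_eq0; apply/eqP.
  have <- := @FTC2_I2pi R (part t \o G) (part t \o g)
    (within_part (t := t) cG) (within_part (t := t) cg) (fun x _ => is_cderive_part t x dG).
  by rewrite -part_cintegral ig part0.
have [z|u [du cu uE]] := @solve_monic [:: - b%:C%C; -1; 0] G _ cG.
  rewrite /root horner_Poly /= => /eqP zE; apply: (@nonresonant 0 b) => //.
    apply/eqP => z0; move: zE; rewrite z0 !mulr0 !add0r => /eqP.
    by rewrite oppr_eq0 (inj_eq (@complexI _)) (negbTE b0).
  apply/eqP; rewrite -subr_eq0 -[X in _ == X](mulr0 z) -zE; apply/eqP; ring.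
have u3E : u 3%N = G + u 1%N + cst b%:C%C * u 0%N.
  apply/funext => x; rewrite !fctE -uE /= !big_ord_recl big_ord0 /=; ring.
pose c := cintegral (u 0%N) / (2 * pi)%:C%C.
pose v k := if k == 0%N then u 0%N - cst c else
  if k == 4%N then g + u 2%N + cst b%:C%C * u 1%N else u k.
have [[d0 p0] [d1 p1] [d2 p2]] := And3 (du 0%N isT) (du 1%N isT) (du 2%N isT).
have dv0 : is_cderive (v 0%N) (v 1%N).
  apply: is_cderive_eq (is_cderiveB d0 (is_cderive_cst c)) _ => x.
  by rewrite !fctE subr0.
have dv3 : is_cderive (v 3%N) (v 4%N).
  rewrite /v /= u3E; apply: is_cderiveD; last exact: is_cderiveZ.
  exact: is_cderiveD.
exists v; first split.
- case=> [|[|[|[|]]]] //= _; split=> //; rewrite /v /=.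
  + by rewrite !fctE p0.
  + by rewrite u3E !fctE pG p0 p1.
- rewrite /v /=; apply: ccontinuousD; last first.
    apply: ccontinuousM; first exact: ccontinuous_cst.
    exact: is_cderive_continuous d1.
  by apply: ccontinuousD => //; exact: is_cderive_continuous d2.
- by move=> x; rewrite /v /= !fctE; ring.
rewrite /v /= cintegralB_cst; last exact: is_cderive_continuous d0.
rewrite /c [_ * (_ / _)]mulrC divfK ?subrr //.
by rewrite (inj_eq (@complexI _)) gt_eqF // pi2_gt0.
Qed.

End Existence.

(** * Complex weak derivatives and square-integrable functions *)

Section ComplexWeak.
Variable R : realType.
Implicit Types (f g u v : R -> R[i]) (z : R[i]) (phi : R -> R).
Local Notation mu := (@lebesgue_measure R).
Local Notation Re := complex.Re.
Local Notation Im := complex.Im.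

Lemma part_mulr t (x : R[i]) (r : R) : part t (x * r%:C%C) = part t x * r.
Proof. by rewrite mulrC partZ mulrC. Qed.

Lemma weak_derivativeP n u v :
  weak_derivative n u v <-> forall t, rweak n (part t \o u) (part t \o v).
Proof.
have E (w : R -> R[i]) phi t : part t (cintegral (fun x => w x * (phi x)%:C%C)) =
    \int[mu]_(x in I2pi) ((part t \o w) x * phi x).
  by rewrite part_cintegral; apply: eq_Rintegral => x _; rewrite part_mulr.
have S : (-1) ^+ n = ((-1) ^+ n)%:C%C :> R[i].
  by rewrite -signr_odd -[in RHS]signr_odd; case: (odd n) => //=; rewrite ?expr1 ?expr0 // rmorphN1.
split=> [w t phi tphi|w phi tphi].
  by have /(congr1 (part t)) := w _ tphi; rewrite S partZ !E.
by apply: part_inj => t; rewrite S partZ !E; exact: w.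
Qed.

Lemma normr_part t (x : R[i]) : (`|part t x|)%:C%C <= `|x|.
Proof.
case: t; first exact: normc_ge_Re.
rewrite normc_def /= lecR -sqrtr_sqr ler_wsqrtr // lerDr sqr_ge0 //.
Qed.

Lemma normc_le (x : R[i]) : `|x| <= (`|Re x| + `|Im x|)%:C%C.
Proof.
rewrite normc_def lecR -[leRHS]ger0_norm ?addr_ge0 // -sqrtr_sqr ler_wsqrtr //.
by rewrite sqrrD !real_normK ?num_real // addrAC lerDl mulrn_wge0 ?mulr_ge0.
Qed.

Lemma cvg_part t (T : Type) (F : set_system T) {FF : Filter F}
   (h : T -> R[i]^o) (l : R[i]^o) :
  h x @[x --> F] --> l -> part t (h x) @[x --> F] --> part t l.
Proof.
move=> /cvgrPdist_lt hl; apply/cvgrPdist_lt => e e0.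
have := hl e%:C%C; rewrite ltcR => /(_ e0); apply: filterS => x.
rewrite -partB -ltcR; exact: le_lt_trans (normr_part _ _).
Qed.

Lemma within_partP (h : R -> R[i]^o) : {within I2pi, continuous h} ->
  forall t, {within I2pi, continuous (part t \o h)}.
Proof. by move=> ch t x; apply: cvg_part; exact: ch. Qed.

Lemma ccontinuous_continuous u : ccontinuous u -> continuous (u : R -> R[i]^o).
Proof.
move=> [cr ci] x; apply/cvgrPdist_lt => e e0.
have eE : e = (Re e)%:C%C.
  by move: e0; rewrite ltcE => /andP[/eqP ie _]; apply: complexP.
have e20 : 0 < Re e / 2 by move: e0; rewrite eE ltcR => e0; rewrite divr_gt0.
move/cvgrPdist_lt/(_ _ e20) : (cr x) => hr.
move/cvgrPdist_lt/(_ _ e20) : (ci x) => hi.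
near=> y.
have h1 : `|Re (u x) - Re (u y)| < Re e / 2 by near: y.
have h2 : `|Im (u x) - Im (u y)| < Re e / 2 by near: y.
rewrite (le_lt_trans (normc_le _)) // eE ltcR ReB ImB; lra.
Unshelve. all: by end_near. Qed.

Lemma integrable_fD (g h : R -> R) : mu.-integrable I2pi (EFin \o g) ->
  mu.-integrable I2pi (EFin \o h) ->
  mu.-integrable I2pi (EFin \o (fun x => g x + h x)).
Proof. move=> ig ih.
have H : mu.-integrable I2pi ((EFin \o g) \+ (EFin \o h))%E.
  by apply: integrableD => //; exact: measurable_I2pi.
exact: H. Qed.

Lemma integrable_fZ (k : R) (g : R -> R) : mu.-integrable I2pi (EFin \o g) ->
  mu.-integrable I2pi (EFin \o (fun x => k * g x)).
Proof. move=> ig.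
have H : mu.-integrable I2pi (fun x => (k%:E * (EFin \o g) x)%E).
  by apply: integrableZl => //; exact: measurable_I2pi.
exact: H. Qed.

Lemma integrable_test (g : R -> R) phi : mu.-integrable I2pi (EFin \o g) ->
  test_function phi -> mu.-integrable I2pi (EFin \o (g \* phi)).
Proof.
move=> ig tphi; have cphi := continuous_test tphi.
have cn : {within `[0, 2 * pi], continuous (fun x => `|phi x|)}.
  by apply: continuous_subspaceT => x; apply: cvg_norm; exact: cphi.
have [c _ hc] := EVT_max (ltW (pi2_gt0 R)) cn.
rewrite (_ : _ \o _ = (EFin \o phi) \* (EFin \o g))%E; last first.
  by apply/funext => x /=; rewrite mulrC.
apply: integrableMr => //; first exact: measurable_I2pi.
  apply: measurable_funTS; exact: continuous_measurable_fun.
exists `|phi c|; split; first exact: num_real.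
by move=> M cM x xI; rewrite /= (le_trans _ (ltW cM)) //; exact: hc.
Qed.

Lemma sqr_norm_part u x :
  (Re `|u x|) ^+ 2 = part true (u x) ^+ 2 + part false (u x) ^+ 2.
Proof. by rewrite normc_def /= sqr_sqrtr ?addr_ge0 ?sqr_ge0. Qed.

(** On an interval of finite length, |r| <= 1 + r^2 suffices. *)
Lemma L2_integrable u t : L2 u -> mu.-integrable I2pi (EFin \o (part t \o u)).
Proof.
move=> [mr mi iu].
have m t' : measurable_fun I2pi (part t' \o u) by case: t'.
pose s x := part true (u x) ^+ 2 + part false (u x) ^+ 2.
have is_ : mu.-integrable I2pi (EFin \o s).
  apply/integrableP; split.
    apply/measurable_EFinP; apply: measurable_funD; apply: measurable_funX; exact: m.
  apply: le_lt_trans iu; rewrite le_eqVlt; apply/orP; left; apply/eqP.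
  apply: eq_integral => x _ /=; rewrite sqr_norm_part ger0_norm //.
  by rewrite addr_ge0 ?sqr_ge0.
have i1 : mu.-integrable I2pi (EFin \o (fun x => 1 + s x)).
  apply: integrable_fD => //; apply: integrable_continuous; exact: within_cst.
apply: le_integrable i1; first exact: measurable_I2pi.
  apply/measurable_EFinP; exact: m.
move=> x _; rewrite /= lee_fin [leRHS]ger0_norm ?addr_ge0 ?sqr_ge0 //.
have H (r : R) : `|r| <= 1 + r ^+ 2.
  rewrite -[r ^+ 2]real_normK ?num_real //; move: `|r| => y; nra.
have h1 := sqr_ge0 (part true (u x)); have h2 := sqr_ge0 (part false (u x)).
by apply: le_trans (H _) _; rewrite lerD2l /s; case: (t); rewrite ?lerDl ?lerDr.
Qed.

Lemma ccontinuous_L2 u : ccontinuous u -> L2 u.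
Proof.
move=> cu; have c t : continuous (part t \o u) by exact: continuous_part.
split.
- apply: measurable_funTS; exact: continuous_measurable_fun (c true).
- apply: measurable_funTS; exact: continuous_measurable_fun (c false).
have /integrableP[_] : mu.-integrable I2pi (EFin \o (fun x =>
    (part true \o u) x * (part true \o u) x +
    (part false \o u) x * (part false \o u) x)).
  by apply: integrable_continuous; apply: withinD; apply: withinM; exact: within_part.
apply: le_lt_trans; rewrite le_eqVlt; apply/orP; left; apply/eqP.
apply: eq_integral => x _ /=; rewrite sqr_norm_part -!expr2 ger0_norm //.
by rewrite addr_ge0 ?sqr_ge0.
Qed.

End ComplexWeak.

(** * Weak solutions are classical; the theorem *)

Section Solutions.
Variable R : realType.
Implicit Types (a b : R) (f : R -> R[i]^o) (u v : R -> R[i]) (phi : R -> R).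
Local Notation mu := (@lebesgue_measure R).

Let aeF := ae_filter_ringOfSetsType mu.

Lemma Rintegral_ae_eq (g h : R -> R) : mu.-integrable I2pi (EFin \o g) ->
  mu.-integrable I2pi (EFin \o h) -> {ae mu, forall x, I2pi x -> g x = h x} ->
  \int[mu]_(x in I2pi) g x = \int[mu]_(x in I2pi) h x.
Proof.
move=> ig ih gh; congr fine; apply: ae_eq_integral.
- exact: measurable_I2pi.
- exact: measurable_int ig.
- exact: measurable_int ih.
- by apply: (@filterS _ _ aeF) gh => x /= e /e ->.
Qed.

Lemma rweak_unique n (r g h : R -> R) phi : rweak n r g -> rweak n r h ->
  test_function phi ->
  \int[mu]_(x in I2pi) (g x * phi x) = \int[mu]_(x in I2pi) (h x * phi x).
Proof.
move=> wg wh tphi; have := wg _ tphi; rewrite wh // => /eqP.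
by rewrite (inj_eq (mulfI _)) ?signr_eq0 // => /eqP.
Qed.

(** The fourth derivative, as given by the equation from the source F, the second
    derivative A, the first derivative B and the function C. *)
Definition rhs a b (F A B C : R -> R) x := F x + A x + (b * B x + a * C x).

Lemma integrable_rhs a b (F A B C : R -> R) :
  mu.-integrable I2pi (EFin \o F) -> mu.-integrable I2pi (EFin \o A) ->
  mu.-integrable I2pi (EFin \o B) -> mu.-integrable I2pi (EFin \o C) ->
  mu.-integrable I2pi (EFin \o rhs a b F A B C).
Proof.
move=> iF iA iB iC; apply: integrable_fD; first exact: integrable_fD.
by apply: integrable_fD; exact: integrable_fZ.
Qed.

Lemma integral_rhs a b (F A B C : R -> R) phi :
  mu.-integrable I2pi (EFin \o F) -> mu.-integrable I2pi (EFin \o A) ->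
  mu.-integrable I2pi (EFin \o B) -> mu.-integrable I2pi (EFin \o C) ->
  test_function phi ->
  \int[mu]_(x in I2pi) (rhs a b F A B C x * phi x) =
  \int[mu]_(x in I2pi) (F x * phi x) + \int[mu]_(x in I2pi) (A x * phi x) +
  (b * \int[mu]_(x in I2pi) (B x * phi x) + a * \int[mu]_(x in I2pi) (C x * phi x)).
Proof.
move=> iF iA iB iC tphi.
have i g : mu.-integrable I2pi (EFin \o g) ->
  mu.-integrable I2pi (EFin \o (fun x => g x * phi x)).
  by move=> ig; exact: integrable_test.
have mI := @measurable_I2pi R.
transitivity (\int[mu]_(x in I2pi) ((F x * phi x + A x * phi x) +
   (b * (B x * phi x) + a * (C x * phi x)))).
  by apply: eq_Rintegral => x _; rewrite /rhs; ring.
have ibB := integrable_fZ b (i _ iB); have iaC := integrable_fZ a (i _ iC).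
rewrite RintegralD //; [|exact: integrable_fD (i _ iF) (i _ iA)|exact: integrable_fD ibB iaC].
rewrite RintegralD //; [|exact: i|exact: i].
rewrite RintegralD // RintegralZl //; last exact: i.
by rewrite RintegralZl //; exact: i.
Qed.

(** The part r of a weak solution agrees almost everywhere with the function
    V 0, which solves the equation classically on the open interval; V k stands
    for the k-th derivative of V 0. *)
Definition strong_solution a b (F r : R -> R) (V : nat -> R -> R) :=
  [/\ forall k, (k < 4)%N ->
        {within I2pi, continuous (V k)} /\ V k 0 = V k (2 * pi),
      forall k, (k < 3)%N -> forall x : R, 0 < x < 2 * pi ->
        is_derive x 1 (V k) (V k.+1 x),
      forall x : R, 0 < x < 2 * pi ->
        is_derive x 1 (V 3%N) (rhs a b F (V 2%N) (V 1%N) (V 0%N) x) &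
      {ae mu, forall x, I2pi x -> r x = V 0%N x}].

(** The weak derivatives of u of order less than 4 have continuous
    representatives by periodicity. The equation gives one for order 4, because
    it expresses u'''' by weak derivatives that may be replaced by the
    continuous representatives under integrals against test functions. Then
    du_bois_reymond applies to each pair of consecutive representatives. *)
Lemma solution_is_strong a b f u t : {within I2pi, continuous f} ->
  H4 u -> solution a b f u ->
  exists V, strong_solution a b (part t \o f) (part t \o u) V.
Proof.
move=> cf [Lu _ pu] [u1 [u2 [u4 [[L1 w1] [L2' w2] [L4 w4] eqn]]]].
have /choice[v hv] : forall n, exists v : R -> R[i]^o, (n < 4)%N ->
    [/\ {within I2pi, continuous v}, weak_derivative n u v & v 0 = v (2 * pi)].
  move=> n; have [n4|n4] := boolP (n < 4)%N; last by exists (cst 0).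
  by have [v hv] := pu n n4; exists v.
pose V k := part t \o v k; pose F := part t \o f; pose r := part t \o u.
have cV k : (k < 4)%N -> {within I2pi, continuous (V k)}.
  by move=> /hv[cv _ _]; exact: within_partP.
have wV k : (k < 4)%N -> rweak k r (V k).
  by move=> /hv[_ /weak_derivativeP wv _]; exact: wv.
have cF : {within I2pi, continuous F} by exact: within_partP.
have iF := integrable_continuous cF.
have iV k k4 := integrable_continuous (cV k k4).
have ir : mu.-integrable I2pi (EFin \o r) by exact: L2_integrable.
have i1 := L2_integrable t L1; have i2 := L2_integrable t L2'.
have i4 := L2_integrable t L4.
move/weak_derivativeP/(_ t) : w1 => w1; move/weak_derivativeP/(_ t) : w2 => w2.
move/weak_derivativeP/(_ t) : w4 => w4.
have wr : rweak 4 r (rhs a b F (V 2%N) (V 1%N) (V 0%N)).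
  move=> phi tphi; rewrite w4 //; congr (_ * _).
  have -> : \int[mu]_(x in I2pi) ((part t \o u4) x * phi x) =
     \int[mu]_(x in I2pi) (rhs a b F (part t \o u2) (part t \o u1) r x * phi x).
    apply: Rintegral_ae_eq.
    - exact: integrable_test.
    - by apply: integrable_test => //; exact: integrable_rhs.
    apply: (@filterS _ _ aeF) eqn => x e /e /(congr1 (part t)).
    rewrite !partB !partD !partZ /rhs /= /F /r /= => <-; rewrite partN; ring.
  rewrite !integral_rhs //; try exact: iV.
  rewrite (rweak_unique w2 (wV 2%N isT)) // (rweak_unique w1 (wV 1%N isT)) //.
  rewrite (rweak_unique (n := 0) (r := r) (g := r) _ (wV 0%N isT)) //.
  by move=> psi _; rewrite expr0 mul1r.
exists V; split.
- by move=> k k4; split; [exact: cV|rewrite /V /=; have [_ _ ->] := hv k k4].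
- move=> k k3; have k4 : (k < 4)%N by exact: ltnW.
  apply: du_bois_reymond; [exact: cV|exact: cV|].
  exact: rweak_step (wV k k4) (wV k.+1 k3).
- apply: du_bois_reymond; [exact: cV| |exact: rweak_step (wV 3%N isT) wr].
  apply: withinD; first by apply: withinD => //; exact: cV.
  by apply: withinD; apply: withinM; try exact: within_cst; exact: cV.
- by apply: rweak0_ae => //; [exact: iV|exact: wV].
Qed.

(** The difference of the solutions satisfies the homogeneous equation. *)
Lemma strong_solution_unique a b (F r r' : R -> R) V V' : b != 0 ->
  strong_solution a b F r V -> strong_solution a b F r' V' ->
  forall x, 0 < x < 2 * pi ->
    V 1%N x = V' 1%N x /\ a * V 0%N x = a * V' 0%N x.
Proof.
move=> b0 [cV dV d3 _] [cV' dV' d3' _] x xI.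
pose w k y := V k y - V' k y.
have cw k : (k < 4)%N -> {within I2pi, continuous (w k)}.
  by move=> k4; apply: withinB; [have [] := cV k k4|have [] := cV' k k4].
have pw k : (k < 4)%N -> w k 0 = w k (2 * pi).
  by move=> k4; rewrite /w; have [_ ->] := cV k k4; have [_ ->] := cV' k k4.
have dw k : (k < 3)%N -> forall y : R, 0 < y < 2 * pi -> is_derive y 1 (w k) (w k.+1 y).
  by move=> k3 y yI; apply: is_derive_fB; [exact: dV|exact: dV'].
have dw3 (y : R) : 0 < y < 2 * pi ->
    is_derive y 1 (w 3%N) (w 2%N y + b * w 1%N y + a * w 0%N y).
  move=> yI; apply: is_derive_eq (is_derive_fB (d3 y yI) (d3' y yI)) _.
  rewrite /rhs /w; ring.
have h1 := energy_derive0 b0 cw pw dw dw3 xI; have h0 := energy_zero_order b0 cw pw dw dw3 xI.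
split; first by apply/eqP; rewrite -subr_eq0; apply/eqP.
by apply/eqP; rewrite -subr_eq0 -mulrBr; apply/eqP.
Qed.

Lemma part_ae_eq u v : (forall t, {ae mu, forall x, I2pi x -> part t (u x) = part t (v x)}) ->
  {ae mu, forall x, I2pi x -> u x = v x}.
Proof.
move=> h; apply: (@filterS2 _ _ aeF _ _ _ _ (h true) (h false)) => x h1 h2 xI.
by apply: complexP; [exact: h1|exact: h2].
Qed.

Lemma uniqueness_pos a b f u v : b != 0 -> 0 < a -> {within I2pi, continuous f} ->
  H4 u -> solution a b f u -> H4 v -> solution a b f v ->
  {ae mu, forall x, I2pi x -> v x = u x}.
Proof.
move=> b0 a0 cf Hu su Hv sv; apply: part_ae_eq => t.
have [V sV] := solution_is_strong t cf Hv sv; have [U sU] := solution_is_strong t cf Hu su.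
have VU x : 0 < x < 2 * pi -> V 0%N x = U 0%N x.
  move=> xI; have [_] := strong_solution_unique b0 sV sU xI; apply: mulfI.
  by rewrite gt_eqF.
have e : {ae mu, forall x, I2pi x -> V 0%N x = U 0%N x}.
  by apply: ae_I2pi; exact: aeW.
have [_ _ _ eV] := sV; have [_ _ _ eU] := sU.
by apply: (@filterS3 _ _ aeF _ _ _ _ _ e eV eU) => x e1 e2 e3 xI;
  rewrite [LHS]e2 // e1 // -e3.
Qed.

Lemma inner1 u : inner u (cst 1) = cintegral u.
Proof. by rewrite /inner; congr cintegral; apply/funext => x; rewrite /= oppr0; exact: mulr1. Qed.

(** The difference of the solutions is a constant with zero integral. *)
Lemma uniqueness_zero b f u v : b != 0 -> {within I2pi, continuous f} ->
  H40 u -> solution 0 b f u -> H40 v -> solution 0 b f v ->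
  {ae mu, forall x, I2pi x -> v x = u x}.
Proof.
move=> b0 cf [Hu mu0] su [Hv mv0] sv; apply: part_ae_eq => t.
have [V sV] := solution_is_strong t cf Hv sv; have [U sU] := solution_is_strong t cf Hu su.
have [cV dV _ eV] := sV; have [cU dU _ eU] := sU.
pose w x := V 0%N x - U 0%N x.
have cw : {within I2pi, continuous w}.
  by apply: withinB; [have [] := cV 0%N isT|have [] := cU 0%N isT].
have dw (x : R) : 0 < x < 2 * pi -> is_derive x 1 w 0.
  move=> xI; have [e _] := strong_solution_unique b0 sV sU xI.
  apply: is_derive_eq (is_derive_fB (dV 0%N isT x xI) (dU 0%N isT x xI)) _.
  by rewrite e subrr.
have wc x : I2pi x -> w x = w 0.
  rewrite in_I2pi => xI; apply: (derive0_cst cw dw) => //.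
  by rewrite lexx ltW ?pi2_gt0.
have i0 (z : R -> R[i]) (Z : nat -> R -> R) : H4 z -> inner z (cst 1) = 0 ->
    {within I2pi, continuous (Z 0%N)} ->
    {ae mu, forall x, I2pi x -> (part t \o z) x = Z 0%N x} ->
    \int[mu]_(x in I2pi) Z 0%N x = 0.
  move=> [Lz _ _] z0 cZ ez; rewrite -(Rintegral_ae_eq _ _ ez).
  - by rewrite -(part_cintegral z t) -inner1 z0 part0.
  - exact: L2_integrable.
  - exact: integrable_continuous.
have : \int[mu]_(x in I2pi) w x = 0.
  rewrite (_ : \int[mu]_(x in _) _ = \int[mu]_(x in I2pi) (V 0%N x - 1 * U 0%N x)); last first.
    by apply: eq_Rintegral => x _; rewrite mul1r.
  have [c1 _] := cV 0%N isT; have [c2 _] := cU 0%N isT.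
  by rewrite integral_lincomb // (i0 v V) // (i0 u U) // mulr0 subrr.
rewrite (_ : \int[mu]_(x in _) _ = \int[mu]_(x in @I2pi R) w 0); last first.
  by apply: eq_Rintegral => x; rewrite inE => /wc.
rewrite integral_cst => /eqP; rewrite mulf_eq0 [2 * pi == 0]gt_eqF ?pi2_gt0 // orbF.
move=> /eqP w0.
apply: (@filterS2 _ _ aeF _ _ _ _ eV eU) => x e1 e2 xI.
have := wc x xI; rewrite w0 /w => /eqP; rewrite subr_eq0 => /eqP e3.
by rewrite [LHS]e1 // e3 -e2.
Qed.

(** The source is the derivative of u''' - u' - b u, which is periodic. *)
Lemma solvable_integral0 b f u : {within I2pi, continuous f} ->
  H4 u -> solution 0 b f u -> cintegral f = 0.
Proof.
move=> cf Hu su; apply: part_inj => t.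
have [V [cV dV d3 _]] := solution_is_strong t cf Hu su.
rewrite part_cintegral part0.
have cF := within_partP cf (t := t).
have [[c0 p0] [c1 p1]] := (cV 0%N isT, cV 1%N isT).
have [[c2 p2] [c3 p3]] := (cV 2%N isT, cV 3%N isT).
pose G x := V 3%N x - (V 1%N x + b * V 0%N x).
have cG : {within I2pi, continuous G}.
  by apply: withinB => //; apply: withinD => //; apply: withinM => //; exact: within_cst.
have dG (x : R) : 0 < x < 2 * pi -> is_derive x 1 G (part t (f x)).
  move=> xI.
  apply: is_derive_eq (is_derive_fB (d3 x xI) (is_derive_fD (dV 1%N isT x xI)
    (is_derive_fcM b (dV 0%N isT x xI)))) _.
  rewrite /rhs /=; ring.
by have -> := FTC2_I2pi cG cF dG; rewrite /G p0 p1 p3 subrr.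
Qed.

Section Classical.
Variables (a b : R) (g : R -> R[i]) (u : nat -> R -> R[i]).
Hypothesis cu : classical_solution a b g u.

Lemma classical_continuous k : (k <= 4)%N -> ccontinuous (u k).
Proof.
have [du c4 _] := cu; rewrite leq_eqVlt => /predU1P[-> //|k4].
by have [/is_cderive_continuous] := du k k4.
Qed.

Lemma classical_weak k : (k <= 4)%N -> weak_derivative k (u 0%N) (u k).
Proof.
have [du _ _] := cu; move=> k4; apply/weak_derivativeP => t.
apply: (@rweak_classical R (fun j => part t \o u j)) => j jk.
  by apply: within_part; apply: classical_continuous; exact: leq_trans jk k4.
by move=> x _; apply: is_cderive_part; have [] := du j (leq_trans jk k4).
Qed.

Lemma classical_H4 : H4 (u 0%N).
Proof.
have [du _ _] := cu; split.
- by apply: ccontinuous_L2; exact: classical_continuous.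
- exists (u 4%N); last exact: classical_weak.
  by apply: ccontinuous_L2; exact: classical_continuous.
- move=> n n4; exists (u n); split.
  + apply: continuous_subspaceT; apply: ccontinuous_continuous.
    by apply: classical_continuous; exact: ltnW.
  + by apply: classical_weak; exact: ltnW.
  + by have [] := du n n4.
Qed.

Lemma classical_is_solution f : (forall x, I2pi x -> g x = f x) ->
  solution a b f (u 0%N).
Proof.
move=> gf; have [_ _ uE] := cu; exists (u 1%N), (u 2%N), (u 4%N); split.
- by split; [apply: ccontinuous_L2; exact: classical_continuous|exact: classical_weak].
- by split; [apply: ccontinuous_L2; exact: classical_continuous|exact: classical_weak].
- by split; [apply: ccontinuous_L2; exact: classical_continuous|exact: classical_weak].
apply: aeW => x xI; rewrite uE -gf //; ring.
Qed.

End Classical.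

Lemma ccontinuous_clamp f : {within I2pi, continuous f} ->
  ccontinuous (f \o @clamp R).
Proof.
move=> cf; split.
  exact: (continuous_extend (within_partP cf (t := true))).
exact: (continuous_extend (within_partP cf (t := false))).
Qed.

Lemma cintegral_clamp f : cintegral (f \o @clamp R) = cintegral f.
Proof.
apply: part_inj => t; rewrite !part_cintegral.
by apply: eq_Rintegral => x; rewrite inE => xI; rewrite /= clamp_id.
Qed.

End Solutions.

Theorem theorem1p3 (R : realType) (a b : R) (f : R -> R[i]^o)
    (a_ge0 : 0 <= a) (b_neq0 : b != 0)
    (f_cont : {within I2pi, continuous f}) (f_per : f 0 = f (2 * pi)) :
  (0 < a -> exists_unique_ae (fun u => H4 u /\ solution a b f u)) /\
  (a = 0 ->
    (exists_unique_ae (fun u => H40 u /\ solution a b f u) <->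
     inner f (cst 1) = 0)).
Proof.
have cg := ccontinuous_clamp f_cont.
have gf (x : R) : I2pi x -> (f \o @clamp R) x = f x by move=> xI; rewrite /= clamp_id.
split=> [a_gt0|->].
  have [u cu] := classical_solvable_pos b_neq0 a_gt0 cg.
  have Hu := classical_H4 cu; have su := classical_is_solution cu gf.
  exists (u 0%N); split=> // v [Hv sv].
  exact: (uniqueness_pos b_neq0 a_gt0 f_cont Hu su Hv sv).
rewrite inner1; split=> [[u [[[Hu _] su] _]]|f0].
  exact: solvable_integral0 f_cont Hu su.
have g0 : cintegral (f \o @clamp R) = 0 by rewrite cintegral_clamp.
have [u cu u0] := classical_solvable_zero b_neq0 cg g0.
have Hu : H40 (u 0%N) by split; [exact: classical_H4 cu|rewrite inner1].
have su := classical_is_solution cu gf.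
exists (u 0%N); split=> // v [Hv sv].
exact: (uniqueness_zero b_neq0 f_cont Hu su Hv sv).
Qed.
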